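(* Consider the space of symmetric AM-systems $\{f_-,f_+\}$ (with parameters $a\in(0,1)$, $\gamma>1$, and probability vector $(p_-,p_+)$) with positive endpoint Lyapunov exponents. Then there is a non-empty open set of parameters $(a,\gamma)\in(0,1)\times(1,\infty)$ and probability vectors $(p_-,p_+)$ such that the corresponding stationary measure $\mu$ for the system $\{f_-,f_+\}$ is singular (with respect to Lebesgue measure) with Hausdorff dimension smaller than $1$. More precisely, there exists $\delta>0$ such that for every probability vector $(p_-,p_+)$ with $p_-,p_+<\frac12+\delta$ there is a non-empty open interval $J_{p_-,p_+}\subset(1,\frac32)$, depending continuously on $(p_-,p_+)$, such that for every $\gamma\in J_{p_-,p_+}$ and every $a\in(0,a_{max})$, for some $a_{max}=a_{max}(\gamma)>0$ depending continuously on $\gamma$, the endpoint Lyapunov exponents are positive and \[ \dim_H\mu\leq\frac{p\log p+(1-p)\log(1-p)}{\Big(1-\frac{(1+\gamma)p^2(p+\gamma)}{\gamma-p(1-p)}\Big)\log a}<1, \] where $p=\max(p_-,p_+)$. In particular, in the case $(p_-,p_+)=(\frac12,\frac12)$ we have \[ \dim_H\mu\leq\frac{(1-4\gamma)\log2}{(\gamma-1)(3/2-\gamma)\log a}<1 \] for every $\gamma\in(1,\frac32)$ and every $a\in\Big(0,2^{\frac{1-4\gamma}{(\gamma-1)(3/2-\gamma)}}\Big)$.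
   Context: For $a\in(0,1)$ and $\gamma>1$, the symmetric AM-system with parameters $(a,\gamma)$ is the pair $\{f_-,f_+\}$ of increasing homeomorphisms of $[0,1]$ given by \[ f_-(x)=\begin{cases} a x & x\in[0,x_-]\\ 1-a^{-\gamma}(1-x) & x\in(x_-,1]\end{cases},\qquad f_+(x)=\begin{cases} a^{-\gamma}x & x\in[0,x_+]\\ 1-a(1-x) & x\in(x_+,1]\end{cases}, \] where $x_-=\frac{a^{-\gamma}-1}{a^{-\gamma}-a}$ and $x_+=\frac{1-a}{a^{-\gamma}-a}$. A probability vector is a pair $(p_-,p_+)$ with $p_-,p_+>0$ and $p_-+p_+=1$. The endpoint Lyapunov exponents are \[ \Lambda(0)=p_-\log f_-'(0)+p_+\log f_+'(0)=(p_--\gamma p_+)\log a, \] \[ \Lambda(1)=p_-\log f_-'(1)+p_+\log f_+'(1)=(p_+-\gamma p_-)\log a. \] Both are positive if and only if $\gamma>\max\big(\frac{p_-}{p_+},\frac{p_+}{p_-}\big)$. When both endpoint Lyapunov exponents are positive, it is known that there is a unique Borel probability measure $\mu$ on $[0,1]$ with $\mu=p_-(f_-)_*\mu+p_+(f_+)_*\mu$ and $\mu(\{0,1\})=0$. ''The stationary measure'' of the system always means this $\mu$. It is known to be non-atomic. The Hausdorff dimension of $\mu$ is $\dim_H\mu=\inf\{\dim_H A: A\subset[0,1]\text{ Borel},\ \mu(A)=1\}$. *)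

(* Defs.v *)
From HB Require Import structures.
From mathcomp Require Import all_boot all_order all_algebra.
From mathcomp Require Import all_classical all_reals all_analysis.

Set Implicit Arguments.
Unset Strict Implicit.
Unset Printing Implicit Defensive.

Import Order.TTheory GRing.Theory Num.Theory.
Import numFieldNormedType.Exports.

Local Open Scope classical_set_scope.
Local Open Scope ring_scope.

(* The homeomorphisms of [0,1] are given as total functions on R, by prolonging
   their two affine pieces.  Measures below are carried by [0,1], so the values
   outside [0,1] play no role; the prolongation makes the one-sided derivatives
   at 0 and 1 ordinary derivatives. *)

Definition x_minus {R : realType} (a gamma : R) : R :=
  (a `^ (- gamma) - 1) / (a `^ (- gamma) - a).

Definition x_plus {R : realType} (a gamma : R) : R :=
  (1 - a) / (a `^ (- gamma) - a).

Definition f_minus {R : realType} (a gamma x : R) : R :=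
  if x <= x_minus a gamma then a * x else 1 - a `^ (- gamma) * (1 - x).

Definition f_plus {R : realType} (a gamma x : R) : R :=
  if x <= x_plus a gamma then a `^ (- gamma) * x else 1 - a * (1 - x).

(* A pair p stands for (p_-, p_+). *)
Definition prob_vector {R : realType} (p : R * R) : Prop :=
  [/\ 0 < p.1, 0 < p.2 & p.1 + p.2 = 1].

Definition endpoint_exponent {R : realType} (a gamma : R) (p : R * R) (x : R) : R :=
  p.1 * ln (derive1 (f_minus a gamma) x) +
  p.2 * ln (derive1 (f_plus a gamma) x).

Definition positive_exponents {R : realType} (a gamma : R) (p : R * R) : Prop :=
  0 < endpoint_exponent a gamma p 0 /\ 0 < endpoint_exponent a gamma p 1.

(* Points are ((a, gamma), (p_-, p_+)). *)
Definition AM_space {R : realType} : set ((R * R) * (R * R)) :=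
  [set t | [/\ 0 < t.1.1 < 1, 1 < t.1.2, prob_vector t.2
             & positive_exponents t.1.1 t.1.2 t.2]].

(* A Borel probability measure on [0,1] is a Borel probability measure on R
   giving [0,1] full mass. *)
Definition stationary_measure {R : realType} (a gamma : R) (p : R * R)
    (mu : probability (measurableTypeR R) R) : Prop :=
  [/\ mu `[0, 1]%classic = 1%E,
      mu [set 0; 1] = 0%E
    & forall A : set (measurableTypeR R), measurable A ->
        (mu A = p.1%:E * pushforward mu (f_minus a gamma) A
              + p.2%:E * pushforward mu (f_plus a gamma) A)%E].

Definition lebesgue_singular {R : realType}
    (mu : {measure set (measurableTypeR R) -> \bar R}) : Prop :=
  exists N : set (measurableTypeR R),
    [/\ measurable N, lebesgue_measure N = 0%E & mu (~` N) = 0%E].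

(* The supremum of the empty set is -oo in \bar R; only the value of diam on
   nonempty sets is used. *)
Definition diam {R : realType} (U : set R) : \bar R :=
  ereal_sup [set (`|z.1 - z.2|)%:E | z in U `*` U].

(* diam(U)^s, with the usual convention that the empty set contributes 0 and
   other sets contribute 1 for s = 0. *)
Definition diam_pow {R : realType} (s : R) (U : set R) : \bar R :=
  if `[< U = set0 >] then 0%E else (diam U `^ s)%E.

Definition hausdorff_premeasure {R : realType} (s d : R) (A : set R) : \bar R :=
  ereal_inf [set (\sum_(k <oo) diam_pow s (U k))%E | U in
    [set U : (set R)^nat |
      A `<=` \bigcup_k U k /\ forall k, (diam (U k) <= d%:E)%E]].

Definition hausdorff_measure {R : realType} (s : R) (A : set R) : \bar R :=
  ereal_sup [set hausdorff_premeasure s d A | d in [set d : R | 0 < d]].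

Definition hausdorff_dim {R : realType} (A : set R) : \bar R :=
  ereal_inf [set s%:E | s in [set s : R | 0 <= s /\ hausdorff_measure s A = 0%E]].

Definition measure_hausdorff_dim {R : realType}
    (mu : probability (measurableTypeR R) R) : \bar R :=
  ereal_inf [set hausdorff_dim A | A in
    [set A : set (measurableTypeR R) |
      [/\ measurable A, A `<=` `[0, 1]%classic & mu A = 1%E]]].

Definition dim_bound {R : realType} (a gamma p : R) : R :=
  (p * ln p + (1 - p) * ln (1 - p)) /
  ((1 - (1 + gamma) * p ^+ 2 * (p + gamma) / (gamma - p * (1 - p))) * ln a).

Definition dim_bound_half {R : realType} (a gamma : R) : R :=
  (1 - 4 * gamma) * ln 2 / ((gamma - 1) * (3 / 2 - gamma) * ln a).

Definition prob_vectors_near_half {R : realType} (delta : R) : set (R * R) :=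
  [set p | [/\ prob_vector p, p.1 < 1 / 2 + delta & p.2 < 1 / 2 + delta]].

(* Main.v *)
Require Import Defs.
From HB Require Import structures.
From mathcomp Require Import all_boot all_order all_algebra.
From mathcomp Require Import all_classical all_reals all_analysis measurable_realfun.
From mathcomp Require Import ring lra.

Set Implicit Arguments.
Unset Strict Implicit.
Unset Printing Implicit Defensive.

Import Order.TTheory GRing.Theory Num.Theory.
Import numFieldNormedType.Exports.

Local Open Scope classical_set_scope.
Local Open Scope ring_scope.

(** Put p = max(p_-, p_+), let h be the entropy of (p_-, p_+), and let c be the
contraction_rate of gamma and p.  The bound on the dimension is h / (c |ln a|),
that is, entropy divided by average contraction.  If random compositions of length
n shrink small intervals by about a^(c n), then, as typical words have probability
about exp(- h n), the measure is almost carried by exp(h n) intervals of length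
a^(c n).  For sigma > h / (c |ln a|) the sum of their lengths to the power sigma
tends to 0.  It remains to see why the maps contract on average, although f_+
expands near 0 and f_- near 1.

Fix y slightly larger than x_+ and measure the depth of x near 0 by
s(x) = ln (y / x) / |ln a|.  In the layer x < y, f_- increases s by 1 and f_+
decreases it by gamma.  This walk drifts out of the layer when gamma p_+ > p_-,
so visits to the layer are short.  The function height of the depth makes this
quantitative: its mean change is at most -(gamma p_+ - p_-) in the layer, at most
p_- (gamma + p_-) at the points y <= x < 1/2, and zero for x >= 1/2.  The layer at
1 is the mirror image.  A central point can enter only the layer on its own side,
so the sum of the two heights grows on average by at most p (gamma + p) in the
centre and decreases by at least gamma (1 - p) - p in the layers
(total_height_drift).  A suitable multiple of this sum, added to the cost of a
step, which is sigma times the logarithm of its slope minus the logarithm of its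
probability, gives a quantity whose mean change is at most
h - sigma c |ln a| < 0 at every point of ]0, 1[ (step_cost_mean).

Because the drift is negative at every point and the changes are bounded, a small
exponential moment is at most 1 (exp_moment).  Hence the exponential of the
accumulated cost is a supermartingale, and Markov's inequality
bounds, for each starting point, the probability that an interval grows beyond a
fixed size on the way (escape_prob) and the probability that the accumulated cost
is not very negative at the end (costly_prob).  Starting from the cells of a fine mesh, stationarity carries the mass of the good
cells to their images (mass_good_images), which are few and short (finite_cover).
Countable unions and intersections turn these covers into a set of full measure
which is null for the sigma-dimensional Hausdorff measure (null_carrier), and for
Lebesgue measure when sigma = 1 is allowed. *)

Definition carried_up_to {R : realType} (mu : probability (measurableTypeR R) R)
    (sigma eta : R) : Prop :=
  exists cs : seq (R * R),
  [/\ forall c, c \in cs -> c.1 <= c.2,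
      \sum_(c <- cs) (c.2 - c.1) `^ sigma <= eta
    & ((1 - eta)%:E <=
       mu (\bigcup_(c in [set` cs]) `[c.1, c.2]%classic))%E].

(** Small sums of diameters to the power sigma force small diameters when
sigma > 0, so this is the condition that the sigma-dimensional Hausdorff measure
of A vanishes, with closed intervals as covering sets. *)
Definition sigma_null {R : realType} (sigma : R) (A : set R) : Prop :=
  forall eps : R, 0 < eps -> exists c : nat -> R * R,
  [/\ forall n, (c n).1 <= (c n).2,
      (\sum_(n <oo) (((c n).2 - (c n).1) `^ sigma)%:E <= eps%:E)%E
    & A `<=` \bigcup_n `[(c n).1, (c n).2]%classic].

(** * Random compositions with a Lyapunov function *)

Section RandomWords.
Variables (R : realType) (I : finType).
Implicit Types (w : seq I) (x : R).

Fixpoint words n : seq (seq I) :=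
  if n is m.+1 then [seq i :: w | i <- enum I, w <- words m] else [:: [::]].

Lemma big_words (V : nmodType) n (F : seq I -> V) :
  \sum_(w <- words n.+1) F w = \sum_i \sum_(w <- words n) F (i :: w).
Proof. by rewrite /= big_allpairs_dep big_enum. Qed.

Variables (f : I -> R -> R) (p : I -> R) (e : I -> R -> R).

Fixpoint path_end w x : R := if w is i :: w' then path_end w' (f i x) else x.

Fixpoint word_prob w : R := if w is i :: w' then p i * word_prob w' else 1.

Fixpoint log_size w x : R :=
  if w is i :: w' then e i x + log_size w' (f i x) else 0.

(** An interval of length d starting at x keeps, along the word, length at most r
according to the slope bounds exp(e i x); these bounds are only valid for
intervals of length at most r, whence the test at every prefix. *)
Fixpoint stays_small (r d : R) w x : bool :=
  (d <= r) && (if w is i :: w' then stays_small r (d * expR (e i x)) w' (f i x)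
               else true).

Hypothesis p_gt0 : forall i, 0 < p i.
Hypothesis sum_p : \sum_i p i = 1.
Hypothesis f_mono : forall i x x', x <= x' -> f i x <= f i x'.
Hypothesis f_in : forall i x, 0 < x < 1 -> 0 < f i x < 1.

Lemma p_le1 i : p i <= 1.
Proof. by rewrite -sum_p (bigD1 i)//= lerDl sumr_ge0// => j _; exact/ltW. Qed.

Lemma word_prob_gt0 w : 0 < word_prob w.
Proof. by elim: w => //= i w IH; rewrite mulr_gt0. Qed.

Lemma sum_word_prob n : \sum_(w <- words n) word_prob w = 1.
Proof.
elim: n => [|n IH]; first by rewrite big_seq1.
rewrite big_words -[RHS]sum_p; apply: eq_bigr => i _.
by rewrite -mulr_sumr IH mulr1.
Qed.

Lemma path_end_mono w x x' : x <= x' -> path_end w x <= path_end w x'.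
Proof. by elim: w x x' => //= i w IH x x' xx'; apply: IH; exact: f_mono. Qed.

Lemma path_end_in w x : 0 < x < 1 -> 0 < path_end w x < 1.
Proof. by elim: w x => //= i w IH x x01; apply: IH; exact: f_in. Qed.

Variables (r sigma t delta : R) (G : R -> R).
Hypothesis sigma_gt0 : 0 < sigma.
Hypothesis t_gt0 : 0 < t.
Hypothesis delta_gt0 : 0 < delta.
Hypothesis r_gt0 : 0 < r.
Hypothesis G_ge0 : forall x, 0 <= G x.
Hypothesis e_lip : forall i x x', 0 < x < 1 -> x <= x' <= x + r ->
  f i x' - f i x <= expR (e i x) * (x' - x).
Hypothesis drift : forall x, 0 < x < 1 ->
  \sum_i p i * expR (t * (sigma * e i x - ln (p i) + delta + (G (f i x) - G x)))
    <= 1.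

(** The sum over words of (length of the image)^sigma is the expectation of
exp(cost): dividing by the probability turns the sum into an expectation. *)
Definition cost w x := sigma * log_size w x - ln (word_prob w).

Lemma path_end_contract w (d : R) x x' : 0 < x < 1 -> x <= x' <= x + d ->
  stays_small r d w x ->
  path_end w x' - path_end w x <= d * expR (log_size w x).
Proof.
elim: w d x x' => [|i w IH] d x x' x01 /= /andP[xx' xd].
  by rewrite expR0 => _; lra.
move=> /andP[dr small].
have x'r : x <= x' <= x + r by rewrite xx'/=; lra.
have := e_lip i x01 x'r; have := f_mono i xx'.
have : (x' - x) * expR (e i x) <= d * expR (e i x).
  by rewrite ler_wpM2r ?expR_ge0//; lra.
move=> h1 h2 h3; rewrite expRD mulrA.
by apply: IH; [exact: f_in|lra|].
Qed.

(** A maximal inequality.  By the drift hypothesis, d^(t sigma) exp(t G(x)) is a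
supermartingale for the pair (length, position); it is at least r^(t sigma) as
soon as the length exceeds r. *)
Lemma escape_prob n (d : R) x : 0 < d -> 0 < x < 1 ->
  \sum_(w <- words n) word_prob w * (~~ stays_small r d w x)%:R <=
  expR (t * (sigma * (ln d - ln r) + G x)).
Proof.
elim: n d x => [|n IH] d x d0 x01.
  rewrite big_seq1 /= andbT mul1r; case: (leP d r) => dr /=; first exact: expR_ge0.
  rewrite -[X in X <= _]expR0 ler_expR mulr_ge0// ?(ltW t_gt0)// addr_ge0//.
  by rewrite mulr_ge0// ?(ltW sigma_gt0)// subr_ge0 ler_ln// ltW.
case: (leP d r) => dr; last first.
  apply: (@le_trans _ _ 1).
    rewrite -[leRHS](sum_word_prob n.+1); apply: ler_sum => w _.
    apply: ler_piMr; first exact/ltW/word_prob_gt0.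
    by case: (stays_small _ _ _ _)=> /=. 
  rewrite -[X in X <= _]expR0 ler_expR mulr_ge0// ?(ltW t_gt0)// addr_ge0//.
  by rewrite mulr_ge0// ?(ltW sigma_gt0)// subr_ge0 ler_ln// ltW.
rewrite big_words.
have -> : \sum_i \sum_(w <- words n)
    word_prob (i :: w) * (~~ stays_small r d (i :: w) x)%:R =
  \sum_i p i * \sum_(w <- words n)
    word_prob w * (~~ stays_small r (d * expR (e i x)) w (f i x))%:R.
  apply: eq_bigr => i _; rewrite mulr_sumr; apply: eq_bigr => w _ /=.
  by rewrite dr mulrA.
set E := expR _.
apply: (@le_trans _ _ (E * \sum_i p i *
   expR (t * (sigma * e i x - ln (p i) + delta + (G (f i x) - G x))))).
  rewrite mulr_sumr; apply: ler_sum => i _.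
  rewrite mulrCA ler_pM2l//.
  apply: (le_trans (IH _ _ _ (f_in i x01))); first by rewrite mulr_gt0// expR_gt0.
  rewrite /E -expRD ler_expR -mulrDr ler_pM2l// lnM ?posrE ?expR_gt0// expRK.
  have : ln (p i) <= 0 by rewrite ln_le0// p_le1.
  move: delta_gt0; lra.
by rewrite -[leRHS]mulr1 ler_pM2l ?expR_gt0//; exact: drift.
Qed.

(** The drift hypothesis, iterated along words of length n. *)
Lemma sum_exp_cost n x : 0 < x < 1 ->
  \sum_(w <- words n) word_prob w *
     expR (t * (cost w x + n%:R * delta + G (path_end w x))) <= expR (t * G x).
Proof.
elim: n x => [|n IH] x x01.
  by rewrite big_seq1 /cost /= ln1 mulr0 mul0r subr0 !add0r mul1r.
rewrite big_words.
apply: (@le_trans _ _ (expR (t * G x) * \sum_i p i *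
   expR (t * (sigma * e i x - ln (p i) + delta + (G (f i x) - G x))))).
  rewrite mulr_sumr; apply: ler_sum => i _.
  have -> : \sum_(w <- words n) word_prob (i :: w) *
      expR (t * (cost (i :: w) x + n.+1%:R * delta + G (path_end (i :: w) x))) =
    p i * (expR (t * (sigma * e i x - ln (p i) + delta)) *
    \sum_(w <- words n) word_prob w *
      expR (t * (cost w (f i x) + n%:R * delta + G (path_end w (f i x))))).
    rewrite mulrA mulr_sumr; apply: eq_bigr => w _ /=.
    rewrite -!mulrA; congr (_ * _); rewrite mulrCA; congr (_ * _).
    rewrite -expRD; congr expR.
    rewrite /cost /= lnM ?posrE ?word_prob_gt0// -natr1; ring.
  rewrite [leRHS]mulrCA ler_pM2l//.
  apply: le_trans (_ : expR (t * (sigma * e i x - ln (p i) + delta)) *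
     expR (t * G (f i x)) <= _).
    by rewrite ler_pM2l ?expR_gt0//; apply: IH; exact: f_in.
  by rewrite -!expRD ler_expR -!mulrDr; lra.
by rewrite -[leRHS]mulr1 ler_pM2l ?expR_gt0//; exact: drift.
Qed.

(** Markov's inequality for sum_exp_cost, since G >= 0 at the end point. *)
Lemma costly_prob n (c : R) x : 0 < x < 1 ->
  \sum_(w <- words n) word_prob w * (- (n%:R * c) < cost w x)%R%:R <=
  expR (t * (G x - n%:R * (delta - c))).
Proof.
move=> x01.
have -> : expR (t * (G x - n%:R * (delta - c))) =
    expR (t * G x) * expR (- (t * (n%:R * (delta - c)))).
  by rewrite -expRD; congr expR; ring.
apply: le_trans (_ : _ <= (\sum_(w <- words n) word_prob w *
    expR (t * (cost w x + n%:R * delta + G (path_end w x)))) *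
    expR (- (t * (n%:R * (delta - c))))) _; last first.
  by rewrite ler_pM2r ?expR_gt0//; exact: sum_exp_cost.
rewrite mulr_suml; apply: ler_sum => w _.
rewrite -mulrA ler_pM2l ?word_prob_gt0// -expRD.
case: ltP => [h|_] /=; last exact: expR_ge0.
rewrite -[X in X <= _]expR0 ler_expR -mulrN -mulrDr.
apply: mulr_ge0; first exact: ltW.
have := G_ge0 (path_end w x).
move: h; lra.
Qed.

Variable mu : probability (measurableTypeR R) R.
Hypothesis mu_stat : forall A : set (measurableTypeR R), measurable A ->
  mu A = (\sum_i (p i)%:E * mu (f i @^-1` A))%E.

Lemma path_end_measurable w (A : set (measurableTypeR R)) :
  measurable A -> measurable (path_end w @^-1` A : set (measurableTypeR R)).
Proof.
move=> mA; rewrite -[_ @^-1` _]setTI.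
apply: (@nondecreasing_measurable R setT (path_end w)) => //.
by move=> x x' xx'; exact: path_end_mono.
Qed.

Lemma stationary_words n (A : set (measurableTypeR R)) : measurable A ->
  mu A = (\sum_(w <- words n) (word_prob w)%:E * mu (path_end w @^-1` A))%E.
Proof.
elim: n A => [|n IH] A mA; first by rewrite big_seq1 /= mul1e.
rewrite big_words exchange_big/= (IH A mA); apply: eq_bigr => w _.
rewrite mu_stat; last exact: path_end_measurable.
rewrite ge0_sume_distrr; last first.
  by move=> i _; rewrite mule_ge0// lee_fin ltW.
by apply: eq_bigr => i _; rewrite muleA -EFinM [in LHS]mulrC.
Qed.

Lemma interior_mass (eta : R) : 0 < eta ->
  mu [set x : R | 0 < x < 1] = 1%E ->
  exists2 theta : R, 0 < theta < 1/2 &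
    ((1 - eta)%:E <= mu `[theta, (1 - theta)%R[%classic)%E.
Proof.
move=> eta0 mu01.
pose F n := `[(n.+3%:R : R)^-1, 1 - (n.+3%:R)^-1[%classic : set R.
have F0 n : 0 < (n.+3%:R : R)^-1 by rewrite invr_gt0.
have UF : \bigcup_n F n = [set x | 0 < x < 1].
  rewrite eqEsubset; split => x.
    case=> n _; rewrite /F /= in_itv/= => /andP[h1 h2].
    by move: h1 h2 (F0 n) => /=; set q := _^-1 => *; apply/andP; split; lra.
  move=> /= /andP[x0 x1].
  have m0 : 0 < Num.min x (1 - x) by rewrite lt_min x0/= subr_gt0.
  have := @unstable.ltr_bound R (Num.min x (1 - x))^-1.
  set n := Num.bound _ => hn.
  have : (n.+3%:R : R)^-1 < Num.min x (1 - x).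
    rewrite invf_plt ?posrE//; apply: lt_trans hn _.
    by rewrite ltr_nat ltnS leqW.
  rewrite lt_min => /andP[h1 h2]; exists n => //.
  by rewrite /F /= in_itv/= (ltW h1)/=; move: h2; set q := _^-1 => ?; lra.
have mF n : measurable (F n : set (measurableTypeR R)) by exact: measurable_itv.
have mUF : measurable (\bigcup_n F n : set (measurableTypeR R)) by exact: bigcup_measurable.
have ndF : nondecreasing_seq F.
  move=> m n mn; apply/subsetPset => x; rewrite /F /= !in_itv/=.
  have : (n.+3%:R : R)^-1 <= (m.+3%:R : R)^-1 by rewrite lef_pV2 ?posrE// ler_nat.
  by set q := _^-1; set q' := _^-1 => h /andP[h1 h2]; apply/andP; split; lra.
have cv : mu \o F @ \oo --> 1%E.
  rewrite -mu01 -[X in mu X]UF.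
  exact: (nondecreasing_cvg_mu mF mUF ndF).
apply: contrapT => none.
have : (1 <= (1 - eta)%:E :> \bar R)%E.
  apply: cvge_to_le cv _; apply: nearW => n /=.
  rewrite leNgt; apply/negP => h; apply: none.
  exists (n.+3%:R)^-1; last exact: ltW.
  by rewrite F0/= div1r ltf_pV2 ?posrE// ltr_nat.
rewrite lee_fin; lra.
Qed.

Lemma bigsetU_steps (x : nat -> R) m : (forall j, x j <= x j.+1) ->
  \big[setU/set0]_(j < m) `[x j, x j.+1[%classic = `[x 0%N, x m[%classic :> set R.
Proof.
move=> x_nd; elim: m => [|m IH]; first by rewrite big_ord0 set_itvco0// lexx.
have x0m : x 0%N <= x m.
  by elim: m {IH} => // m IH; exact: le_trans IH (x_nd m).
rewrite big_ord_recr/= IH; apply/seteqP; split => y; rewrite /= !in_itv/=.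
  by case=> /andP[h1 h2]; apply/andP; split; move: (x_nd m); lra.
case/andP=> h1 h2; case: (ltP y (x m)) => h3; [left|right]; first by rewrite h1.
exact/andP.
Qed.

Lemma trivIset_steps (x : nat -> R) : (forall j, x j <= x j.+1) ->
  trivIset setT (fun j => `[x j, x j.+1[%classic : set R).
Proof.
move=> x_nd; apply: ltn_trivIset => k j jk.
have xjk : x j.+1 <= x k.
  by apply: (@homo_leq _ x (fun a b => a <= b)) => // ? ? ?; exact: le_trans.
apply/seteqP; split => y //=; rewrite !in_itv/= => -[/andP[h1 h2] /andP[h3 h4]].
by move: h1 h2 h3 h4; lra.
Qed.

(** The cell [x j, x j.+1[ is sent into B by every word that is good for j, so it
contributes to mu(B) its own mass times the probability of these words. *)
Lemma mass_good_images (x : nat -> R) (good : seq I -> nat -> bool) (m n : nat)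
    (kappa : R) (B : set (measurableTypeR R)) :
  (forall j, x j <= x j.+1) -> measurable B ->
  (forall j, (j < m)%N ->
     1 - kappa <= \sum_(w <- words n) word_prob w * (good w j)%:R) ->
  (forall w j, w \in words n -> (j < m)%N -> good w j ->
     `[path_end w (x j), path_end w (x j.+1)]%classic `<=` B) ->
  ((1 - kappa)%:E * mu `[x 0%N, x m[%classic <= mu B)%E.
Proof.
move=> x_nd mB good_prob goodB.
pose Q j : set (measurableTypeR R) := `[x j, x j.+1[%classic.
have mQ j : measurable (Q j) by exact: measurable_itv.
have tQ m' : trivIset setT (fun j : 'I_m' => Q j).
  by have := trivIset_steps x_nd; rewrite -/Q => tQ;
    apply/trivIsetP => i j _ _ ij; move/trivIsetP : tQ; apply.
have -> : mu `[x 0%N, x m[%classic = (\sum_(j < m) mu (Q j))%E.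
  by rewrite -bigsetU_steps// measure_bigsetU_ord.
have muQ j : mu (Q j) = (fine (mu (Q j)))%:E by rewrite fineK// fin_num_measure.
rewrite (stationary_words n mB).
apply: (@le_trans _ _ (\sum_(w <- words n) (word_prob w)%:E *
    \sum_(j < m | good w j) mu (Q j))%E); last first.
  rewrite big_seq [leRHS]big_seq; apply: lee_sum => w wn.
  rewrite lee_pmul2l ?lte_fin ?word_prob_gt0// ?fin_numE//.
  rewrite -(@measure_bigsetU_ord _ _ _ mu m (good w))//.
  apply: le_measure; rewrite ?inE//.
  - by apply: bigsetU_measurable.
  - exact: path_end_measurable.
  - apply: (big_ind (fun S => S `<=` _)) => [|S S' h h'|j gj] //.
      by rewrite subUset.
    move=> y; rewrite /Q /= in_itv/= => /andP[h1 h2].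
    apply: (goodB w j) => //=; rewrite in_itv/=.
    by rewrite !path_end_mono// ltW.
rewrite ge0_sume_distrr//.
have -> : (\sum_(w <- words n) (word_prob w)%:E * (\sum_(j < m | good w j) mu (Q j)) =
  \sum_(j < m) (\sum_(w <- words n) word_prob w * (good w j)%:R)%:E * mu (Q j))%E.
  transitivity (\sum_(w <- words n) \sum_(j < m)
      (word_prob w * (good w j)%:R)%:E * mu (Q j))%E.
    apply: eq_bigr => w _; rewrite big_mkcond ge0_sume_distrr; last first.
      by move=> j _; case: ifP.
    apply: eq_bigr => j _; case: (good w j); first by rewrite mulr1.
    by rewrite mulr0 mule0 mul0e.
  rewrite exchange_big/=; apply: eq_bigr => j _.
  rewrite -sumEFin ge0_sume_distrl// => w _.
  by rewrite lee_fin mulr_ge0// ltW// word_prob_gt0.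
apply: lee_sum => j _; rewrite muQ -!EFinM lee_fin ler_wpM2r ?fine_ge0//.
exact: good_prob.
Qed.

Hypothesis G_locally_bounded : forall theta : R, 0 < theta ->
  exists C, forall x, theta <= x <= 1 - theta -> G x <= C.
Hypothesis mu_interior : mu [set x : R | 0 < x < 1] = 1%E.

Lemma exp_decay (A B c : R) : 0 < B -> 0 < c ->
  exists n0, forall n, (n0 <= n)%N -> A * expR (- (n%:R * c)) <= B.
Proof.
move=> B0 c0; case: (leP A 0) => [A0|A0].
  exists 0%N => n _; apply: le_trans (ltW B0).
  by rewrite mulr_le0_ge0// expR_ge0.
exists (Num.bound ((ln A - ln B) / c)) => n hn.
have h : (ln A - ln B) / c <= n%:R.
  by apply/ltW; apply: lt_le_trans (unstable.ltr_bound _) _; rewrite ler_nat.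
rewrite -[A]lnK ?posrE// -expRD -[leRHS]lnK ?posrE// ler_expR.
by move: h; rewrite ler_pdivrMr//; lra.
Qed.

(** Cut a compact part of ]0, 1[ into cells of length at most d.  A word is good
for a cell if the left end of the cell neither escapes to scale r nor ends with a
cost above - n delta / 2.  Bad words have small probability; over good words, the
sum of the lengths to the power sigma is at most d^sigma exp(- n delta / 2) per
cell, and the number of cells does not depend on n. *)
Lemma finite_cover (eta : R) : 0 < eta -> carried_up_to mu sigma eta.
Proof.
move=> eta0.
have eta3 : 0 < eta / 3 by lra.
have [theta /andP[th0 th1] mass_th] := interior_mass eta3 mu_interior.
have [C GC] := G_locally_bounded th0.
(* With this d, escape_prob bounds the escape probability by eta / 3. *)
pose d := r * expR (- ((C - ln (eta / 3) / t) / sigma)).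
have d0 : 0 < d by rewrite mulr_gt0// expR_gt0.
pose m := (Num.bound ((1 - 2 * theta) / d)).+1.
pose rho := (1 - 2 * theta) / m%:R.
have rho0 : 0 < rho by rewrite divr_gt0//; lra.
have rhod : rho <= d.
  rewrite ler_pdivrMr// [d * _]mulrC -ler_pdivrMr//; apply/ltW.
  by apply: lt_trans (unstable.ltr_bound _) _; rewrite ltr_nat.
pose x j := theta + j%:R * rho.
have xS j : x j.+1 = x j + rho by rewrite /x -natr1; ring.
have x_nd j : x j <= x j.+1 by rewrite xS lerDl ltW.
have xm : x m = 1 - theta by rewrite /x /rho mulrC divfK ?pnatr_eq0//; lra.
have x_core j : (j < m)%N -> theta <= x j <= 1 - theta.
  move=> jm; rewrite -xm /x lerDl mulr_ge0 ?(ltW rho0)//=.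
  by rewrite lerD2l ler_pM2r// ler_nat ltnW.
have x01 j : (j < m)%N -> 0 < x j < 1.
  by move=> /x_core; set y := x j => h; lra.
have delta2 : 0 < delta / 2 by rewrite divr_gt0.
(* From n1 on costly words are rare; from n2 on the total size is below eta. *)
have [n1 hn1] := exp_decay (expR (t * C)) eta3 (mulr_gt0 t_gt0 delta2).
have [n2 hn2] := exp_decay (m%:R * d `^ sigma) eta0 delta2.
pose n := maxn n1 n2.
pose good w j := stays_small r d w (x j) && (cost w (x j) <= - (n%:R * (delta / 2))).
have good_prob j : (j < m)%N ->
    1 - (eta / 3 + eta / 3) <= \sum_(w <- words n) word_prob w * (good w j)%:R.
  move=> jm; have Gx := GC _ (x_core j jm).
  rewrite lerBlDr -[X in X <= _](sum_word_prob n).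
  apply: (@le_trans _ _ (\sum_(w <- words n) (word_prob w * (good w j)%:R +
     (word_prob w * (~~ stays_small r d w (x j))%:R +
      word_prob w * (- (n%:R * (delta / 2)) < cost w (x j))%R%:R)))).
    apply: ler_sum => w _; rewrite -!mulrDr.
    rewrite -[X in X <= _]mulr1 ler_pM2l ?word_prob_gt0// /good.
    by case: stays_small => /=; case: leP => /=; lra.
  rewrite big_split/= big_split/= lerD2l lerD//.
    apply: le_trans (escape_prob n d0 (x01 _ jm)) _.
    rewrite -[leRHS]lnK ?posrE// ler_expR /d lnM ?posrE ?expR_gt0// expRK.
    apply: (@le_trans _ _ (t * (- (C - ln (eta / 3) / t) + C))).
      rewrite ler_pM2l// lerD//.
      rewrite [X in _ * X](_ : _ = - ((C - ln (eta / 3) / t) / sigma)); last ring.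
      by rewrite mulrN mulrC divfK// gt_eqF.
    rewrite opprB addrNK mulrC divfK// gt_eqF//.
  apply: le_trans (costly_prob n (delta / 2) (x01 _ jm)) _.
  apply: le_trans (hn1 n (leq_maxl _ _)).
  rewrite -expRD ler_expR.
  have : t * G (x j) <= t * C by rewrite ler_pM2l.
  by set y := n%:R; lra.
pose cs := [seq (path_end w (x j), path_end w (x j.+1)) |
  j <- iota 0 m, w <- [seq w <- words n | good w j]].
exists cs; split.
- move=> c /allpairsPdep[j [w [_ _ ->]]] /=; exact: path_end_mono.
- rewrite big_allpairs_dep.
  apply: (@le_trans _ _
      (\sum_(j <- iota 0 m) d `^ sigma * expR (- (n%:R * (delta / 2))))); last first.
    rewrite big_const_seq count_predT size_iota iter_addr_0 -[X in X <= _]mulr_natl.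
    by rewrite mulrA; exact: hn2 n (leq_maxr _ _).
  rewrite big_seq [leRHS]big_seq; apply: ler_sum => j.
  rewrite mem_iota add0n => /andP[_ jm].
  rewrite big_filter; set E := d `^ sigma * _.
  rewrite -[leRHS]mulr1 -(sum_word_prob n) mulr_sumr big_mkcond/= /E.
  apply: ler_sum => w _; case: ifPn => [/andP[small cheap]|_]; last first.
    by rewrite !mulr_ge0 ?powR_ge0 ?expR_ge0// ltW// word_prob_gt0.
  have xd : x j <= x j.+1 <= x j + d by rewrite x_nd xS lerD2l.
  have len := path_end_contract (x01 j jm) xd small.
  have len0 : 0 <= path_end w (x j.+1) - path_end w (x j).
    by rewrite subr_ge0 path_end_mono.
  apply: (@le_trans _ _ ((d * expR (log_size w (x j))) `^ sigma)).
    by apply: ge0_ler_powR; rewrite ?nnegrE ?(ltW sigma_gt0)// (le_trans len0).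
  rewrite powRM ?expR_ge0 ?(ltW d0)// -expRM -mulrA ler_pM2l ?powR_gt0//.
  rewrite -[word_prob w]lnK ?posrE ?word_prob_gt0// -expRD ler_expR.
  by move: cheap; rewrite /cost; set q := n%:R * _; lra.
- apply: (@le_trans _ _ ((1 - (eta / 3 + eta / 3))%:E * mu `[x 0%N, x m[%classic)%E).
    rewrite xm [x 0%N](_ : _ = theta); last by rewrite /x mul0r addr0.
    move: mass_th; rewrite -[mu _]fineK ?fin_num_measure// -EFinM !lee_fin.
    have : fine (mu `[theta, (1 - theta)%R[%classic) <= 1.
      by rewrite -lee_fin fineK ?fin_num_measure// probability_le1.
    set q := fine _ => q1 q2; have : eta * q <= eta by rewrite ler_piMr// ltW.
    lra.
  apply: (@mass_good_images _ good m n) => // [|w j wn jm gj].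
    rewrite bigcup_seq; apply: bigsetU_measurable => c _; exact: measurable_itv.
  apply: (@bigcup_sup _ _ (path_end w (x j), path_end w (x j.+1))) => /=.
  apply/allpairsPdep; exists j, w; split => //; first by rewrite mem_iota.
  by rewrite mem_filter gj.
Qed.
End RandomWords.

(** * Null sets and dimension *)

Section NullCovers.
Variable R : realType.

(** Enumerates a family indexed by a countable type as a series, with zero at the
indices that encode nothing. *)
Lemma nneseries_pickle_inv (T : countType) (a : T -> \bar R) :
  (forall i, (0 <= a i)%E) ->
  (\sum_(n <oo) oapp a 0%E (pickle_inv n))%E = \esum_(i in [set: T]) a i.
Proof.
move=> a0; rewrite nneseries_esumT; last first.
  by move=> n; case: (pickle_inv n) => /=.
have inj : set_bij [set: T] (range (@pickle T)) pickle.
  split; [by move=> n _; exists n| |exact: subset_refl].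
  by move=> i j _ _; exact: (pcan_inj pickleK_inv).
transitivity (\esum_(n in range (@pickle T)) oapp a 0%E (pickle_inv n)).
  rewrite [RHS]esum_mkcond; apply: eq_esum => n _.
  case: ifPn => // /negP; rewrite inE/= => nrange.
  case E : (pickle_inv n) => [i|//]; exfalso; apply: nrange; exists i => //.
  by have := @pickle_invK T n; rewrite E.
rewrite (reindex_esum _ _ _ _ inj); apply: eq_esum => i _.
by rewrite /= pickleK_inv.
Qed.

Lemma nneseries_nth (T : Type) (x0 : T) (g : T -> R) (s : seq T) :
  (forall x, 0 <= g x) -> g x0 = 0 ->
  (\sum_(j <oo) (g (nth x0 s j))%:E)%E = (\sum_(x <- s) g x)%:E.
Proof.
move=> g0 gx0; rewrite (nneseries_split 0 (size s))//; last first.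
  by move=> k _; rewrite lee_fin.
rewrite eseries0 ?adde0 ?add0n; last first.
  by move=> k sk _; rewrite nth_default ?gx0.
by rewrite (big_nth x0) -sumEFin.
Qed.

Variables (mu : probability (measurableTypeR R) R) (sigma : R).
Hypothesis sigma_gt0 : 0 < sigma.
Hypothesis mu_finite_cover : forall eta : R, 0 < eta -> carried_up_to mu sigma eta.

(** The union over k of covers that miss mass eps / 2^(k+1) misses nothing, and
its total size is at most eps. *)
Lemma countable_cover (eps : R) : 0 < eps -> exists c : nat -> R * R,
  [/\ forall n, (c n).1 <= (c n).2,
      (\sum_(n <oo) (((c n).2 - (c n).1) `^ sigma)%:E <= eps%:E)%E
    & mu (\bigcup_n `[(c n).1, (c n).2]%classic) = 1%E].
Proof.
move=> eps0.
pose eta k := eps / (2 ^ k.+1)%:R.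
have eta0 k : 0 < eta k by rewrite divr_gt0// ltr0n expn_gt0.
have [cs csP] := choice (fun k => mu_finite_cover (eta0 k)).
(* Indices beyond the k-th list give the degenerate cell [0, 0], of size 0. *)
pose cell (i : nat * nat) := nth (0, 0) (cs i.1) i.2.
pose c n : R * R := oapp cell (0, 0) (pickle_inv n).
have cellP i : (cell i).1 <= (cell i).2.
  rewrite /cell; have [h _ _] := csP i.1.
  have [lt|ge] := ltnP i.2 (size (cs i.1)); first exact/h/mem_nth.
  by rewrite nth_default.
exists c; split.
- by move=> n; rewrite /c; case: (pickle_inv n).
- pose g (x : R * R) := (x.2 - x.1) `^ sigma.
  have g00 : g (0, 0) = 0 by rewrite /g subrr powR0// gt_eqF.
  have g0 x : 0 <= g x by exact: powR_ge0.
  rewrite (eq_eseriesr (g := fun n =>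
      oapp (fun i => (g (cell i))%:E) 0%E (pickle_inv n))); last first.
    by move=> n _; rewrite /c; case: (pickle_inv n) => [i|] //=; exact: (congr1 EFin g00).
  rewrite nneseries_pickle_inv; last by move=> i; rewrite lee_fin.
  have -> : [set: nat * nat] = [set: nat] `*`` (fun=> [set: nat]).
    by apply/seteqP; split.
  rewrite -(esum_esum (a := fun k j => (g (cell (k, j)))%:E)); last first.
    by move=> *; rewrite lee_fin.
  apply: le_trans (epsilon_trick0 predT (ltW eps0)).
  rewrite -nneseries_esumT; last by move=> k; apply: esum_ge0 => *; rewrite lee_fin.
  apply: lee_nneseries => [k _ _|k _].
    by apply: esum_ge0 => *; rewrite lee_fin.
  rewrite -nneseries_esumT; last by move=> j; rewrite lee_fin.
  rewrite [leLHS](nneseries_nth (cs k) g0 g00) lee_fin.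
  by have [_ ? _] := csP k.
have mU : measurable (\bigcup_n `[(c n).1, (c n).2]%classic : set (measurableTypeR R)).
  by apply: bigcup_measurable => n _; exact: measurable_itv.
apply/eqP; rewrite eq_le probability_le1//=.
apply/lee_addgt0Pr => e e0.
pose k := Num.bound (eps / e).
have ek : eta k <= e.
  rewrite /eta ler_pdivrMr ?ltr0n ?expn_gt0// mulrC -ler_pdivrMr//.
  apply/ltW/(lt_trans (unstable.ltr_bound _)).
  by rewrite ltr_nat -/k ltnW// ltn_expl.
rewrite -leeBlDr// -EFinB.
apply: (@le_trans _ _ (1 - eta k)%:E); first by rewrite lee_fin lerD2l lerN2.
have [_ _ h] := csP k; apply: le_trans h _.
apply: le_measure; rewrite ?inE//.
  by rewrite bigcup_seq; apply: bigsetU_measurable => ? _; exact: measurable_itv.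
move=> y [d /= dcs dy]; exists (pickle (k, index d (cs k))) => //=.
by rewrite /c pickleK_inv /= /cell /= nth_index.
Qed.

Lemma null_carrier : mu `[0, 1]%classic = 1%E ->
  exists A : set (measurableTypeR R),
  [/\ measurable A, A `<=` `[0, 1]%classic, mu A = 1%E
    & sigma_null sigma A].
Proof.
move=> mu01.
have e0 (m : nat) : 0 < (m.+1%:R : R)^-1 by rewrite invr_gt0.
have [c cP] := choice (fun m => countable_cover (e0 m)).
pose B m : set (measurableTypeR R) := \bigcup_n `[(c m n).1, (c m n).2]%classic.
have mB m : measurable (B m).
  by apply: bigcup_measurable => n _; exact: measurable_itv.
have m01 : measurable (`[0, 1]%classic : set (measurableTypeR R)).
  exact: measurable_itv.
have mcapB : measurable (\bigcap_m B m) by exact: bigcap_measurable.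
have null S : measurable S -> mu S = 1%E -> mu.-negligible (~` S).
  move=> mS muS; apply/negligibleP; first exact: measurableC.
  by have := probability_setC mu mS; rewrite muS subee.
exists (`[0, 1]%classic `&` \bigcap_m B m); split.
- exact: measurableI.
- exact: subIsetl.
- have : mu.-negligible (~` (`[0, 1]%classic `&` \bigcap_m B m)).
    rewrite setCI setC_bigcap; apply: negligibleU; first exact: null.
    apply: negligible_bigcup => m; apply: null => //.
    by have [_ _ ?] := cP m.
  have mX := measurableI _ _ m01 mcapB.
  move/negligibleP => /(_ (measurableC mX)) muC.
  have := probability_setC mu mX; rewrite (muC : mu _ = 0%E).
  set q := mu _; have : q \is a fin_num by rewrite fin_num_measure.
  by case: q => // q _ /eqP; rewrite -EFinB eqe eq_sym subr_eq0 => /eqP <-.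
- move=> eps eps0.
  pose m := Num.bound eps^-1.
  have [c1 c2 _] := cP m; exists (c m); split => //.
    apply: le_trans c2 _; rewrite lee_fin invf_ple ?posrE//.
    by apply/ltW/(lt_trans (unstable.ltr_bound _)); rewrite ltr_nat.
  by move=> x [_ /(_ m I)].
Qed.

Lemma diam_itv (a b : R) : a <= b -> diam `[a, b]%classic = (b - a)%:E.
Proof.
move=> ab; apply/eqP; rewrite eq_le; apply/andP; split.
  apply: ge_ereal_sup => _ [[x y] /= [hx hy] <-].
  move: hx hy; rewrite !in_itv/= => /andP[? ?] /andP[? ?].
  by rewrite lee_fin ler_norml; apply/andP; split; lra.
apply: ereal_sup_ubound; exists (b, a); last first.
  by rewrite /= ger0_norm// subr_ge0.
by split; rewrite /= in_itv/= lexx ab.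
Qed.

Lemma diam_pow_itv (a b : R) : a <= b ->
  diam_pow sigma `[a, b]%classic = ((b - a) `^ sigma)%:E.
Proof.
move=> ab; rewrite /diam_pow diam_itv//.
case: asboolP => [E|_]; last by rewrite poweR_EFin.
have : `[a, b]%classic a by rewrite /= in_itv/= lexx.
by rewrite E.
Qed.

Variable A : set (measurableTypeR R).
Hypothesis A_null : sigma_null sigma A.

Lemma null_hausdorff_measure0 : hausdorff_measure sigma A = 0%E.
Proof.
have ge0 U : (0 <= diam_pow sigma U :> \bar R)%E.
  by rewrite /diam_pow; case: ifP => // _; exact: poweR_ge0.
have pre0 d : 0 < d -> hausdorff_premeasure sigma d A = 0%E.
  move=> d0; apply/eqP; rewrite eq_le; apply/andP; split; last first.
    by apply: le_ereal_inf_tmp => _ [U _ <-]; exact: nneseries_ge0.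
  apply/lee_addgt0Pr => e e0; rewrite add0e.
  (* A cover of total size at most d^sigma only uses intervals of length <= d. *)
  have m0 : 0 < Num.min e (d `^ sigma) by rewrite lt_min e0 powR_gt0.
  have [c [c1 c2 c3]] := A_null m0.
  apply: (@le_trans _ _ (\sum_(n <oo) (((c n).2 - (c n).1) `^ sigma)%:E)%E).
    apply: ereal_inf_lbound; exists (fun n => `[(c n).1, (c n).2]%classic).
      split=> // n; rewrite diam_itv// lee_fin.
      rewrite leNgt; apply/negP => dc.
      have : d `^ sigma < ((c n).2 - (c n).1) `^ sigma.
        by apply: gt0_ltr_powR; rewrite ?nnegrE ?subr_ge0// ltW.
      apply/negP; rewrite -leNgt -lee_fin.
      apply: le_trans (le_trans c2 _); last by rewrite lee_fin ge_min lexx orbT.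
      have := @nneseries_lim_ge R (fun n => (((c n).2 - (c n).1) `^ sigma)%:E) predT 0 n.+1.
      move=> /(_ (fun _ _ _ => powR_ge0 _ _)); apply: le_trans.
      rewrite big_nat_recr//= leeDr// sume_ge0// => i _.
      by rewrite lee_fin powR_ge0.
    by apply: eq_eseriesr => n _; rewrite diam_pow_itv.
  by apply: le_trans c2 _; rewrite lee_fin ge_min lexx.
rewrite /hausdorff_measure; apply/eqP; rewrite eq_le; apply/andP; split.
  by apply: ge_ereal_sup => _ [d /= d0 <-]; rewrite pre0.
by apply: ereal_sup_ubound; exists 1 => //=; rewrite pre0.
Qed.

Lemma null_hausdorff_dim : (hausdorff_dim A <= sigma%:E)%E.
Proof.
apply: ereal_inf_lbound; exists sigma => //=; split; first exact: ltW.
exact: null_hausdorff_measure0.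
Qed.

Lemma null_lebesgue0 : sigma = 1 -> measurable A -> lebesgue_measure A = 0%E.
Proof.
move=> s1 mA; apply/eqP; rewrite eq_le measure_ge0 andbT.
apply/lee_addgt0Pr => e e0; rewrite add0e.
have [c [c1 c2 c3]] := A_null e0; apply: le_trans c2.
apply: le_trans (measure_sigma_subadditive _ _ mA c3) _.
  by move=> n; exact: measurable_itv.
apply: lee_nneseries => [n _ _|n _]; first exact: measure_ge0.
rewrite s1 powRr1 ?subr_ge0//.
rewrite [leLHS](lebesgue_measure_itv `[(c n).1, (c n).2]) /= lte_fin.
by case: ifP => // _; rewrite lee_fin subr_ge0.
Qed.
End NullCovers.

(** * From negative mean to small exponential moment *)

Section ExponentialMoment.
Variables (R : realType) (I : finType) (p : I -> R).
Hypothesis p_gt0 : forall i, 0 < p i.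
Hypothesis sum_p : \sum_i p i = 1.

Lemma expR_le_quadratic (y : R) : y <= 1/2 -> expR y <= 1 + y + 2 * y ^+ 2.
Proof.
move=> y2; have h := expR_ge1Dx (- y).
have : expR y * (1 - y) <= 1.
  by rewrite -[leRHS](expRxMexpNx_1 y) ler_pM2l ?expR_gt0.
have y1 : 0 < 1 - y by lra.
rewrite -ler_pdivlMr// => /le_trans; apply.
rewrite mul1r -[X in X <= _]mul1r ler_pdivrMr//.
have : 0 <= y ^+ 2 * (1 - 2 * y) by rewrite mulr_ge0 ?sqr_ge0//; lra.
lra.
Qed.

(** Since exp(y) <= 1 + y + 2 y^2 for y <= 1/2, for small t the second-order term
is dominated by the negative mean.  The same t serves all bounded D; below, D
depends on a point of ]0, 1[ and t must not. *)
Lemma exp_moment (B delta : R) : 0 < delta -> 0 <= B ->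
  exists2 t : R, 0 < t & forall D : I -> R,
    (forall i, `|D i| <= B) -> \sum_i p i * D i <= - (2 * delta) ->
    \sum_i p i * expR (t * (D i + delta)) <= 1.
Proof.
move=> d0 B0; pose M := B + delta.
have M0 : 0 < M by rewrite /M; lra.
(* This t makes the quadratic term 2 (t M)^2 equal to t delta. *)
pose t := delta / (2 * M ^+ 2).
have M2 : 0 < 2 * M ^+ 2 by rewrite mulr_gt0// exprn_gt0.
have t0 : 0 < t by rewrite divr_gt0.
have tM2 : 2 * (t * M) ^+ 2 = t * delta.
  by rewrite /t; field; rewrite gt_eqF.
have tM : t * M <= 1/2.
  rewrite -(@ler_pM2r _ (2 * M)) ?mulr_gt0//.
  have -> : t * M * (2 * M) = delta by rewrite /t; field; rewrite gt_eqF.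
  by rewrite /M; lra.
exists t => // D DB meanD.
apply: (@le_trans _ _ (\sum_i (p i * (1 + 2 * (t * delta)) + t * (p i * D i)))).
  apply: ler_sum => i _.
  have := DB i; rewrite ler_norml => /andP[D1 D2].
  have y1 : t * (D i + delta) <= t * M by rewrite ler_pM2l// lerD2r.
  have y2 : - (t * M) <= t * (D i + delta).
    by rewrite -mulrN ler_pM2l// /M; lra.
  have ysq : (t * (D i + delta)) ^+ 2 <= (t * M) ^+ 2.
    by rewrite -ler_sqrt ?sqr_ge0// !sqrtr_sqr [leRHS]ger0_norm ?ler_norml ?y1 ?y2//
      mulr_ge0// ltW.
  have := expR_le_quadratic (le_trans y1 tM).
  have -> : p i * (1 + 2 * (t * delta)) + t * (p i * D i) =
    p i * (1 + 2 * (t * delta) + t * D i) by ring.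
  by rewrite ler_pM2l//; move=> h; apply: le_trans h _; lra.
rewrite big_split/= -mulr_suml sum_p -mulr_sumr mul1r.
have : t * \sum_i p i * D i <= t * - (2 * delta) by rewrite ler_pM2l.
lra.
Qed.
End ExponentialMoment.

(** * The maps f_- and f_+ *)

(** A lower bound for the average contraction, in units of -ln a: the mean
logarithm of the slope of a step is at most -1, plus (1 + gamma) P if the point
lies in a boundary layer, and the long-run proportion of time spent in the layers
is at most P (P + gamma) / (gamma - P (1 - P)). *)
Definition contraction_rate {R : realType} (gamma P : R) : R :=
  1 - (1 + gamma) * P ^+ 2 * (P + gamma) / (gamma - P * (1 - P)).

Section AMSystem.
Variables (R : realType) (a gamma : R).
Hypothesis a_half : 0 < a <= 1/2.
Hypothesis gamma_gt1 : 1 < gamma.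
Hypothesis steep : 2 <= a * a `^ (- gamma).

Let b := a `^ (- gamma).

Let a01 : 0 < a < 1.
Proof. by have := a_half; lra. Qed.

Lemma expansion_gt2 : 2 < b.
Proof.
have := steep; rewrite -/b => h; have /andP[a0 a1] := a01.
have : a * b < b by rewrite gtr_pMl// powR_gt0.
lra.
Qed.

Lemma slope_gap_gt0 : 0 < b - a.
Proof. by have := expansion_gt2; have /andP[a0 a1] := a01; lra. Qed.

Lemma f_minusE x : f_minus a gamma x = Num.max (a * x) (1 - b * (1 - x)).
Proof.
rewrite /f_minus /x_minus -/b ler_pdivlMr ?slope_gap_gt0//.
by case: leP => h; [rewrite max_l|rewrite max_r]=> //; lra.
Qed.

Lemma f_plusE x : f_plus a gamma x = Num.min (b * x) (1 - a * (1 - x)).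
Proof.
rewrite /f_plus /x_plus -/b ler_pdivlMr ?slope_gap_gt0//.
by case: leP => h; [rewrite min_l|rewrite min_r]=> //; lra.
Qed.

Lemma f_plus_sym x : f_plus a gamma x = 1 - f_minus a gamma (1 - x).
Proof.
rewrite f_plusE f_minusE.
by case: (leP (b * x)) => h1; case: (leP (a * (1 - x))) => h2; lra.
Qed.

Lemma f_minus_sym x : f_minus a gamma x = 1 - f_plus a gamma (1 - x).
Proof. by rewrite f_plus_sym !subKr. Qed.

Let l := - ln a.

Lemma oppr_ln_gt0 : 0 < l.
Proof. by rewrite oppr_gt0 ln_lt0. Qed.

Lemma expR_opp_l : expR (- l) = a.
Proof. by rewrite opprK lnK// posrE; have /andP[] := a01. Qed.

Lemma expR_gamma_l : expR (gamma * l) = b.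
Proof.
have /andP[a0 a1] := a01.
by rewrite /b /powR gt_eqF// /l; congr expR; ring.
Qed.

Lemma f_minus_ge x : a * x <= f_minus a gamma x.
Proof. by rewrite f_minusE le_max lexx. Qed.

Lemma f_plus_le x : f_plus a gamma x <= b * x.
Proof. by rewrite f_plusE ge_min lexx. Qed.

Lemma f_minus_mono x x' : x <= x' -> f_minus a gamma x <= f_minus a gamma x'.
Proof.
move=> xx'; have /andP[a0 a1] := a01; have b2 := expansion_gt2.
have h1 : a * x <= a * x' by rewrite ler_pM2l.
have h2 : b * (1 - x') <= b * (1 - x) by rewrite ler_pM2l//; lra.
rewrite !f_minusE; case: (leP (a * x)) => ?; case: (leP (a * x')) => ?; lra.
Qed.

Lemma f_plus_mono x x' : x <= x' -> f_plus a gamma x <= f_plus a gamma x'.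
Proof. by move=> xx'; rewrite !f_plus_sym lerD2l lerN2 f_minus_mono// lerD2l lerN2. Qed.

Lemma f_minus_in x : 0 < x < 1 -> 0 < f_minus a gamma x < 1.
Proof.
move=> /andP[x0 x1]; have /andP[a0 a1] := a01; have b2 := expansion_gt2.
have h1 : 0 < a * x by rewrite mulr_gt0.
have h2 : 0 < b * (1 - x) by rewrite mulr_gt0//; lra.
have h3 : a * x < x by rewrite gtr_pMl.
by rewrite f_minusE; case: (leP (a * x)) => ?; lra.
Qed.

Lemma f_plus_in x : 0 < x < 1 -> 0 < f_plus a gamma x < 1.
Proof.
move=> x01; rewrite f_plus_sym.
by have : 0 < f_minus a gamma (1 - x) < 1; [apply: f_minus_in; lra|lra].
Qed.

Lemma x_plus_bounds : 0 < x_plus a gamma < a / 2.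
Proof.
have /andP[a0 a1] := a01; have b2 := expansion_gt2; have ba := slope_gap_gt0.
rewrite /x_plus -/b divr_gt0//=; last lra.
rewrite ltr_pdivrMr//.
have h : a * a < 2 * a by rewrite ltr_pM2r//; lra.
have := steep; rewrite -/b; lra.
Qed.

Lemma x_minusE : x_minus a gamma = 1 - x_plus a gamma.
Proof. by rewrite /x_minus /x_plus -/b; field; rewrite gt_eqF// slope_gap_gt0. Qed.

(** The layers are x < y and x > 1 - y.  Any y strictly between x_+ and a / 2
would do.  The gap r above x_+ keeps intervals of length r that start in the
centre away from the expanding branches, so that f_- and f_+ contract them by
exactly a.  The bound y < a / 2 gives f_-(x) >= y for x >= 1/2, so that a layer is
entered only from its own half of the interval. *)
Let y := (x_plus a gamma + a / 2) / 2.
Let r := y - x_plus a gamma.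

Lemma r_gt0 : 0 < r.
Proof. by have := x_plus_bounds; rewrite /r /y; lra. Qed.

Lemma y_bounds : 0 < y < a / 2.
Proof. by have := x_plus_bounds; rewrite /y; lra. Qed.

Lemma f_minus_contract x x' : x <= 1 - y -> x <= x' <= x + r ->
  f_minus a gamma x' - f_minus a gamma x <= expR (- l) * (x' - x).
Proof.
move=> xy /andP[xx' xr]; rewrite expR_opp_l /f_minus x_minusE.
have -> : x' <= 1 - x_plus a gamma by move: xr xy; rewrite /r; lra.
by rewrite (le_trans xx') ?mulrBr//; move: xr xy; rewrite /r; lra.
Qed.

Lemma f_minus_lip x x' : x <= x' ->
  f_minus a gamma x' - f_minus a gamma x <= expR (gamma * l) * (x' - x).
Proof.
move=> xx'; rewrite expR_gamma_l.
have /andP[a0 a1] := a01; have b2 := expansion_gt2.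
have h1 : a * (x' - x) <= b * (x' - x) by rewrite ler_wpM2r ?subr_ge0//; lra.
by rewrite !f_minusE; case: (leP (a * x)) => ?; case: (leP (a * x')) => ?; lra.
Qed.

Lemma f_plus_contract x x' : y <= x -> x <= x' <= x + r ->
  f_plus a gamma x' - f_plus a gamma x <= expR (- l) * (x' - x).
Proof.
move=> yx /andP[xx' xr]; rewrite expR_opp_l.
have yp := r_gt0; rewrite /r subr_gt0 in yp.
rewrite /f_plus !leNgt (lt_le_trans yp yx) (lt_le_trans yp (le_trans yx xx'))/=.
lra.
Qed.

Lemma f_plus_lip x x' : x <= x' ->
  f_plus a gamma x' - f_plus a gamma x <= expR (gamma * l) * (x' - x).
Proof.
move=> xx'; rewrite !f_plus_sym.
have : 1 - x' <= 1 - x by lra.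
by move/f_minus_lip; lra.
Qed.

(** * Depth in the boundary layers *)

Let s (x : R) := (ln y - ln x) / l.

Lemma depth_a x : 0 < x -> s (a * x) = s x + 1.
Proof.
have /andP[a0 _] := a01 => x0; rewrite /s lnM ?posrE// /l.
by field; rewrite lt_eqF// ln_lt0.
Qed.

Lemma depth_b x : 0 < x -> s (b * x) = s x - gamma.
Proof.
have l0 := oppr_ln_gt0.
move=> x0; rewrite /s lnM ?posrE// -?expR_gamma_l ?expR_gt0// expRK.
by field; rewrite gt_eqF.
Qed.

Lemma depth_le x x' : 0 < x -> x <= x' -> s x' <= s x.
Proof.
move=> x0 xx'; rewrite ler_pM2r ?invr_gt0 ?oppr_ln_gt0// lerD2l lerN2.
by rewrite ler_ln ?posrE// (lt_le_trans x0).
Qed.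

Lemma depth_gt0 x : 0 < x -> (0 < s x) = (x < y).
Proof.
move=> x0; rewrite pmulr_lgt0 ?invr_gt0 ?oppr_ln_gt0// subr_gt0 ltr_ln ?posrE//.
by have /andP[] := y_bounds.
Qed.

Lemma depth_le0 x : y <= x -> s x <= 0.
Proof.
have /andP[y0 _] := y_bounds.
by move=> yx; rewrite leNgt depth_gt0 -?leNgt// (lt_le_trans y0).
Qed.

(** By height_step, height divided by gamma (1 - q) - q bounds the expected time
that a walk with steps 1 (probability q) and -gamma (probability 1 - q) started at
t spends in the positive half-line: the walk leaves from a depth at most gamma,
hence descends at most gamma + t in all.  For t <= 1 < gamma a first step downwards
already leaves, with a descent of gamma only, which improves gamma + t to
gamma + q t.  It is this improvement that makes the mean cost of entering the
layer q (gamma + q). *)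
Definition height (q t : R) : R :=
  if t <= 0 then 0 else if t <= 1 then gamma + q * t else gamma + t.

Lemma height0 (q t : R) : t <= 0 -> height q t = 0.
Proof. by rewrite /height => ->. Qed.

Lemma height_low (q t : R) : 0 < t <= 1 -> height q t = gamma + q * t.
Proof. by move=> /andP[t0 t1]; rewrite /height leNgt t0 t1. Qed.

Lemma height_high (q t : R) : 1 < t -> height q t = gamma + t.
Proof.
by move=> t1; rewrite /height !leNgt t1 (lt_trans ltr01 t1).
Qed.

Lemma height_bounds (q t : R) : 0 <= q <= 1 ->
  Num.max 0 t <= height q t <= gamma + Num.max 0 t.
Proof.
have g1 := gamma_gt1.
move=> /andP[q0 q1]; rewrite /height; case: (leP t 0) => t0.
  by rewrite lexx addr0; lra.
have qt0 : 0 <= q * t by rewrite mulr_ge0// ltW.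
have qt1 : q * t <= t by rewrite ler_piMl// ltW.
by case: (leP t 1) => t1; apply/andP; split; lra.
Qed.

Lemma height_ge0 (q t : R) : 0 <= q <= 1 -> 0 <= height q t.
Proof.
by move=> /height_bounds => /(_ t) /andP[h _]; rewrite (le_trans _ h)// le_max lexx.
Qed.

Lemma height_diff (q t t' d : R) : 0 <= q <= 1 -> `|t - t'| <= d ->
  `|height q t - height q t'| <= gamma + d.
Proof.
have g1 := gamma_gt1.
move=> q01; have := height_bounds t q01; have := height_bounds t' q01.
rewrite !ler_norml => + + /andP[].
by case: (leP 0 t) => ?; case: (leP 0 t') => ? => /andP[? ?] /andP[? ?] ? ?;
  apply/andP; split; lra.
Qed.

Lemma height_step (q t : R) : 0 < q < 1 -> 0 < t ->
  q * height q (t + 1) + (1 - q) * height q (t - gamma) <=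
  height q t - (gamma * (1 - q) - q).
Proof.
have g1 := gamma_gt1.
move=> /andP[q0 q1] t0.
have q' : 0 < 1 - q by lra.
rewrite (@height_high q (t + 1)); last lra.
have [t1|t1] := leP t 1.
  rewrite height0; last lra.
  by rewrite height_low ?t0//; lra.
rewrite (height_high _ t1).
have q01 : 0 <= q <= 1 by lra.
have drop : height q (t - gamma) <= t.
  have [h|h] := leP (t - gamma) 0; first by rewrite height0// ltW.
  have /andP[_ +] := height_bounds (t - gamma) q01.
  by rewrite (max_r (ltW h)); lra.
rewrite -(ler_pM2l q') in drop; lra.
Qed.

Lemma height_enter (q t : R) : 0 < q < 1 -> t <= 0 -> height q (t + 1) <= gamma + q.
Proof.
have g1 := gamma_gt1.
move=> /andP[q0 q1] t0; have [h|h] := leP (t + 1) 0.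
  by rewrite height0//; lra.
rewrite height_low ?h/=; last lra.
by rewrite lerD2l ler_piMr; lra.
Qed.

(** * Drift of the height *)

Definition layer (q x : R) : R := height q (s x).

Lemma layer_ge0 (q x : R) : 0 <= q <= 1 -> 0 <= layer q x.
Proof. exact: height_ge0. Qed.

Lemma layer_centre (q x : R) : y <= x -> layer q x = 0.
Proof. by move=> yx; rewrite /layer height0// depth_le0. Qed.

(** f_+(x) is the smaller of a^(- gamma) x and a point above y, and points above y
have height 0. *)
Lemma layer_f_plus (q x : R) : 0 < x < 1 ->
  layer q (f_plus a gamma x) = height q (s x - gamma).
Proof.
move=> /andP[x0 x1]; have /andP[a0 a1] := a01; have /andP[_ a2] := a_half.
have /andP[y0 ya] := y_bounds.
rewrite -depth_b// /layer f_plusE.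
have [//|h] := leP (b * x) (1 - a * (1 - x)).
have ax0 : 0 < a * x by rewrite mulr_gt0.
have h1 : y <= 1 - a * (1 - x) by lra.
by rewrite !height0//; apply: depth_le0 => //; exact: le_trans h1 (ltW h).
Qed.

(** On its expanding branch f_- starts from x > x_- and stays above a x_- > y. *)
Lemma layer_f_minus (q x : R) : 0 < x < 1 ->
  layer q (f_minus a gamma x) = height q (s x + 1) \/
  y <= x /\ layer q (f_minus a gamma x) = 0.
Proof.
move=> /andP[x0 x1]; have /andP[a0 a1] := a01.
have /andP[y0 ya] := y_bounds.
have r0 := r_gt0; have xp := x_plus_bounds.
have yp := r_gt0; rewrite /r subr_gt0 in yp.
rewrite -depth_a// /layer {1}/f_minus; case: leP => h; first by left.
right; move: h; rewrite x_minusE => h; have yx : y <= x by lra.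
split => //; rewrite height0//; apply: depth_le0.
apply: le_trans (f_minus_ge x).
have : a * (1 / 2) <= a * x by rewrite ler_pM2l//; lra.
lra.
Qed.

Lemma layer_f_minus_far (q x : R) : 1 / 2 <= x -> layer q (f_minus a gamma x) = 0.
Proof.
move=> x2; have /andP[a0 a1] := a01.
have /andP[y0 ya] := y_bounds.
apply: layer_centre; apply: le_trans (f_minus_ge x).
have : a * (1 / 2) <= a * x by rewrite ler_pM2l.
lra.
Qed.

Lemma layer_f_plus_centre (q x : R) : y <= x < 1 -> layer q (f_plus a gamma x) = 0.
Proof.
move=> /andP[yx x1]; have /andP[y0 ya] := y_bounds.
rewrite layer_f_plus; last by rewrite (lt_le_trans y0).
have g1 := gamma_gt1.
by rewrite height0//; have := depth_le0 yx; lra.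
Qed.

Lemma layer_jump (q x : R) : 0 <= q <= 1 -> 0 < x < 1 ->
  `|layer q (f_minus a gamma x) - layer q x| <= 2 * gamma /\
  `|layer q (f_plus a gamma x) - layer q x| <= 2 * gamma.
Proof.
move=> q01 x01; have g1 := gamma_gt1; split.
  have [->|[yx ->]] := layer_f_minus q x01.
    apply: le_trans (height_diff q01 (d := 1) _) _; last lra.
    by rewrite addrAC subrr add0r normr1.
  by rewrite (layer_centre _ yx) subrr normr0; lra.
rewrite layer_f_plus//.
apply: le_trans (height_diff q01 (d := gamma) _) _; last lra.
by rewrite addrAC subrr add0r normrN ger0_norm//; lra.
Qed.

Lemma layer_drift_in (q x : R) : 0 < q < 1 -> 0 < x < y ->
  q * layer q (f_minus a gamma x) + (1 - q) * layer q (f_plus a gamma x) <=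
  layer q x - (gamma * (1 - q) - q).
Proof.
move=> q01 /andP[x0 xy]; have /andP[y0 ya] := y_bounds.
have /andP[a0 a1] := a01.
have x01 : 0 < x < 1 by lra.
rewrite layer_f_plus//; have [->|[yx _]] := layer_f_minus q x01; last lra.
by apply: height_step => //; rewrite depth_gt0.
Qed.

Lemma layer_drift_near (q x : R) : 0 < q < 1 -> y <= x < 1 ->
  q * layer q (f_minus a gamma x) + (1 - q) * layer q (f_plus a gamma x) <=
  q * (gamma + q).
Proof.
move=> q01 /andP[yx x1]; have /andP[y0 ya] := y_bounds.
have /andP[q0 q1] := q01; have g1 := gamma_gt1.
have x01 : 0 < x < 1 by rewrite (lt_le_trans y0).
rewrite layer_f_plus_centre ?yx// mulr0 addr0 ler_pM2l//.
have [->|[_ ->]] := layer_f_minus q x01; last lra.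
by apply: height_enter => //; exact: depth_le0.
Qed.

Lemma layer_drift_far (q x : R) : 1 / 2 <= x < 1 ->
  q * layer q (f_minus a gamma x) + (1 - q) * layer q (f_plus a gamma x) = 0.
Proof.
move=> /andP[x2 x1]; have /andP[y0 ya] := y_bounds; have /andP[a0 a1] := a01.
rewrite layer_f_minus_far// layer_f_plus_centre ?mulr0 ?addr0//.
by rewrite x1 andbT; lra.
Qed.

Lemma layer_locally_bounded (q theta x : R) : 0 <= q <= 1 -> 0 < theta -> theta <= x ->
  layer q x <= gamma + Num.max 0 (s theta).
Proof.
move=> q01 th0 thx; have /andP[_ h] := height_bounds (s x) q01.
apply: le_trans h _; rewrite lerD2l ge_max !le_max lexx/=.
by rewrite depth_le// orbT.
Qed.

Variable p : R * R.
Hypothesis pP : prob_vector p.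
Let P := Num.max p.1 p.2.
Let D := gamma * (1 - P) - P.

Definition am_map (i : bool) : R -> R := if i then f_plus a gamma else f_minus a gamma.
Definition am_prob (i : bool) : R := if i then p.2 else p.1.
Definition am_log_slope (i : bool) (x : R) : R :=
  if (if i then y <= x else x <= 1 - y) then - l else gamma * l.
Definition total_height (x : R) : R := layer p.1 x + layer p.2 (1 - x).

Lemma p_bounds : [/\ 0 < p.1 < 1, 0 < p.2 < 1, p.1 <= P, p.2 <= P & P < 1].
Proof.
have [p1 p2 p12] := pP; split; rewrite /P ?le_max ?lexx ?orbT ?gt_max//; lra.
Qed.

(** Of the two layers, at most one can be reached in one step from a given point,
because the halves x < 1/2 and 1 - x < 1/2 are disjoint. *)
Lemma total_height_drift x : 0 < x < 1 ->
  p.1 * total_height (f_minus a gamma x) + p.2 * total_height (f_plus a gamma x)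
  - total_height x <= (if y <= x <= 1 - y then P * (gamma + P) else - D).
Proof.
move=> /andP[x0 x1]; have [p1 p2 p1P p2P P1] := p_bounds.
have g1 := gamma_gt1; have [_ _ p12] := pP.
have /andP[y0 ya] := y_bounds; have /andP[a0 a1] := a01.
pose L q z := q * layer q (f_minus a gamma z) + (1 - q) * layer q (f_plus a gamma z).
have -> : p.1 * total_height (f_minus a gamma x) + p.2 * total_height (f_plus a gamma x)
    - total_height x = (L p.1 x - layer p.1 x) + (L p.2 (1 - x) - layer p.2 (1 - x)).
  rewrite /total_height /L.
  rewrite [1 - f_minus a gamma x](_ : _ = f_plus a gamma (1 - x)); last first.
    by rewrite f_minus_sym subKr.
  rewrite [1 - f_plus a gamma x](_ : _ = f_minus a gamma (1 - x)); last first.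
    by rewrite f_plus_sym subKr.
  have -> : 1 - p.1 = p.2 by lra.
  have -> : 1 - p.2 = p.1 by lra.
  ring.
have P0 : 0 < P by lra.
have PP q : 0 < q <= P -> q * (gamma + q) <= P * (gamma + P).
  by move=> ?; apply: ler_pM; lra.
have DD q : 0 < q <= P -> D <= gamma * (1 - q) - q.
  move=> /andP[q0 qP]; have : gamma * q <= gamma * P by rewrite ler_pM2l//; lra.
  by rewrite /D; lra.
have far q z : 1 / 2 <= z < 1 -> L q z - layer q z = 0.
  move=> z2; rewrite /L layer_drift_far// layer_centre ?subrr//; lra.
have PP0 : 0 <= P * (gamma + P) by rewrite mulr_ge0//; lra.
have [yx|xy] := leP y x; have [xy'|yx'] := leP x (1 - y) => /=.
- have [x2|x2] := leP (1 / 2) x.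
    rewrite (far _ x) ?x2// add0r (layer_centre p.2 (x := 1 - x)) ?subr0; last lra.
    by apply: le_trans (PP p.2 _); [apply: layer_drift_near; lra|lra].
  rewrite (far _ (1 - x)) ?addr0; last lra.
  rewrite (layer_centre p.1 yx) subr0.
  by apply: le_trans (PP p.1 _); [apply: layer_drift_near; lra|lra].
- rewrite (far _ x) ?add0r; last lra.
  have x' : 0 < 1 - x < y by lra.
  have d2 : 0 < p.2 <= P by lra.
  by have := layer_drift_in p2 x'; have := DD p.2 d2; rewrite -/(L _ _); lra.
- rewrite (far _ (1 - x)) ?addr0; last lra.
  have x' : 0 < x < y by lra.
  have d1 : 0 < p.1 <= P by lra.
  by have := layer_drift_in p1 x'; have := DD p.1 d1; rewrite -/(L _ _); lra.
- lra.
Qed.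

Lemma am_log_slope_mean x : 0 < x < 1 ->
  p.1 * am_log_slope false x + p.2 * am_log_slope true x <=
  l * (if y <= x <= 1 - y then - 1 else (1 + gamma) * P - 1).
Proof.
move=> /andP[x0 x1]; have [p1 p2 p1P p2P P1] := p_bounds.
have g1 := gamma_gt1; have [_ _ p12] := pP; have l0 := oppr_ln_gt0.
have /andP[y0 ya] := y_bounds; have /andP[a0 a1] := a01.
have lg q : q <= P -> l * ((1 + gamma) * q) <= l * ((1 + gamma) * P).
  by move=> qP; rewrite !ler_pM2l//; lra.
have h1 := lg _ p1P; have h2 := lg _ p2P.
have p2E : p.2 = 1 - p.1 by lra.
rewrite /am_log_slope; have [yx|xy] := leP y x; have [xy'|yx'] := leP x (1 - y) => /=.
- by rewrite p2E; lra.
- by move: h1; rewrite p2E; lra.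
- by move: h2; rewrite p2E; lra.
- lra.
Qed.

Lemma total_height_ge0 x : 0 <= total_height x.
Proof.
by have [p1 p2 _ _ _] := p_bounds; rewrite addr_ge0// layer_ge0//; lra.
Qed.

Lemma total_height_locally_bounded (theta : R) : 0 < theta ->
  exists C, forall x, theta <= x <= 1 - theta -> total_height x <= C.
Proof.
move=> th0; exists (2 * (gamma + Num.max 0 (s theta))) => x /andP[tx xt].
have [p1 p2 _ _ _] := p_bounds.
have h1 : layer p.1 x <= gamma + Num.max 0 (s theta).
  by apply: layer_locally_bounded => //; lra.
have h2 : layer p.2 (1 - x) <= gamma + Num.max 0 (s theta).
  by apply: layer_locally_bounded => //; lra.
rewrite /total_height; lra.
Qed.

Lemma total_height_jump i x : 0 < x < 1 ->
  `|total_height (am_map i x) - total_height x| <= 4 * gamma.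
Proof.
move=> x01; have [p1 p2 _ _ _] := p_bounds.
have q1 : 0 <= p.1 <= 1 by lra.
have q2 : 0 <= p.2 <= 1 by lra.
have x01' : 0 < 1 - x < 1 by lra.
have [j1 j2] := layer_jump q1 x01; have [j3 j4] := layer_jump q2 x01'.
have add (u v u' v' : R) : `|u - v| <= 2 * gamma -> `|u' - v'| <= 2 * gamma ->
    `|u + u' - (v + v')| <= 4 * gamma.
  move=> h h'; have -> : u + u' - (v + v') = (u - v) + (u' - v') by ring.
  by apply: le_trans (ler_normD _ _) _; lra.
rewrite /total_height /am_map; case: i; apply: add => //.
  by rewrite f_plus_sym subKr.
by rewrite f_minus_sym subKr.
Qed.

Let entropy := - (p.1 * ln p.1 + p.2 * ln p.2).
Let contraction := contraction_rate gamma P.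

Variable sigma : R.
Hypothesis sigma_gt0 : 0 < sigma.
Hypothesis sigma_large : entropy < sigma * (contraction * l).

(* K is chosen so that the means below agree in the centre and in the layers:
K P (gamma + P) = sigma l (1 - c) and K D = sigma l ((1 + gamma) P - (1 - c)). *)
Let K := sigma * l * (1 + gamma) * P / (gamma - P * (1 - P)).

Let step_cost (x : R) (i : bool) := sigma * am_log_slope i x - ln (am_prob i) +
  K * (total_height (am_map i x) - total_height x).

Lemma weight_denom_gt0 : 0 < gamma - P * (1 - P).
Proof.
have [p1 p2 p1P p2P P1] := p_bounds; have g1 := gamma_gt1.
have : P * (1 - P) < 1 by rewrite mulr_ilt1 ?subr_ge0//; lra.
lra.
Qed.

Lemma weight_ge0 : 0 <= K.
Proof.
have [p1 p2 p1P p2P P1] := p_bounds; have g1 := gamma_gt1.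
have l0 := oppr_ln_gt0; have s0 := sigma_gt0; have d0 := weight_denom_gt0.
by rewrite /K divr_ge0 ?(ltW d0)// !mulr_ge0//; lra.
Qed.

(** In the centre the contraction -sigma l pays for the growth of the height; in a
layer the decrease of the height pays for the expanding branch. *)
Lemma step_cost_mean x : 0 < x < 1 ->
  \sum_i am_prob i * step_cost x i <= entropy - sigma * (contraction * l).
Proof.
move=> x01; have [p1 p2 p1P p2P P1] := p_bounds; have g1 := gamma_gt1.
have l0 := oppr_ln_gt0; have s0 := sigma_gt0; have d0 := weight_denom_gt0; have k0 := weight_ge0.
have [_ _ p12] := pP.
rewrite big_bool /=.
have hd := total_height_drift x01; have hs := am_log_slope_mean x01.
rewrite -(ler_pM2l s0) in hs.
have {}hd := ler_wpM2l k0 hd.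
have -> : p.2 * step_cost x true + p.1 * step_cost x false =
  sigma * (p.1 * am_log_slope false x + p.2 * am_log_slope true x) + entropy +
  K * (p.1 * total_height (f_minus a gamma x) +
       p.2 * total_height (f_plus a gamma x) - total_height x).
  rewrite /step_cost /entropy /am_map /=.
  have -> : p.2 = 1 - p.1 by lra.
  ring.
have KP : K * (P * (gamma + P)) = sigma * l * (1 - contraction).
  by rewrite /K /contraction /contraction_rate; field; rewrite gt_eqF.
have KD : K * D = sigma * l * ((1 + gamma) * P - (1 - contraction)).
  by rewrite /K /contraction /contraction_rate /D; field; rewrite gt_eqF.
by move: hs hd; case: ifP => _ hs hd; move: KP KD; lra.
Qed.

Lemma step_cost_bounded : exists2 B : R, 0 <= B &
  forall x i, 0 < x < 1 -> `|step_cost x i| <= B.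
Proof.
have g1 := gamma_gt1; have l0 := oppr_ln_gt0; have s0 := sigma_gt0.
exists (sigma * (gamma * l) + (`|ln p.1| + `|ln p.2|) + K * (4 * gamma)) => [|x i x01].
  apply: addr_ge0; [apply: addr_ge0|]; rewrite ?addr_ge0//.
    by rewrite !mulr_ge0// ?(ltW s0) ?(ltW l0)//; lra.
  by rewrite mulr_ge0 ?weight_ge0//; lra.
apply: le_trans (ler_normD _ _) _; apply: lerD; last first.
  rewrite normrM (ger0_norm weight_ge0) ler_wpM2l ?weight_ge0//.
  exact: total_height_jump.
apply: le_trans (ler_normB _ _) _; apply: lerD; last first.
  by rewrite /am_prob; case: i; rewrite ?lerDl ?lerDr.
rewrite normrM (gtr0_norm s0) ler_pM2l// /am_log_slope.
have gl : l <= gamma * l by rewrite ler_peMl; lra.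
have gl0 : 0 < gamma * l by lra.
by case: (if i then _ else _); rewrite ?(gtr0_norm gl0)// normrN gtr0_norm.
Qed.

Lemma am_finite_cover (mu : probability (measurableTypeR R) R) (eta : R) :
  stationary_measure a gamma p mu -> 0 < eta -> carried_up_to mu sigma eta.
Proof.
move=> [mu01 muends mustat] eta0.
have [p1 p2 _ _ _] := p_bounds; have [_ _ p12] := pP.
have prob_gt0 i : 0 < am_prob i by rewrite /am_prob; case: i; lra.
have sum_prob : \sum_i am_prob i = 1 by rewrite big_bool /= addrC.
have [B B0 stepB] := step_cost_bounded.
pose delta := (sigma * (contraction * l) - entropy) / 2.
have delta0 : 0 < delta by rewrite divr_gt0// subr_gt0.
have [t t0 moment] := exp_moment prob_gt0 sum_prob delta0 B0.
have l0 := oppr_ln_gt0.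
apply: (@finite_cover R bool am_map am_prob am_log_slope prob_gt0 sum_prob _ _
  r sigma t delta (fun x => K * total_height x)) => //.
- by move=> [] x x'; [exact: f_plus_mono|exact: f_minus_mono].
- by move=> [] x; [exact: f_plus_in|exact: f_minus_in].
- exact: r_gt0.
- by move=> x; rewrite mulr_ge0 ?weight_ge0 ?total_height_ge0.
- move=> i x x' x01 xx'r; have xx' : x <= x' by case/andP: xx'r.
  rewrite /am_map /am_log_slope; case: i; case: ifP => h.
  + exact: f_plus_contract.
  + exact: f_plus_lip.
  + exact: f_minus_contract.
  + exact: f_minus_lip.
- move=> x x01; have := moment (step_cost x) (fun i => stepB x i x01).
  have mean : \sum_i am_prob i * step_cost x i <= - (2 * delta).
    by apply: le_trans (step_cost_mean x01) _; rewrite /delta; lra.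
  move=> /(_ mean); apply: le_trans; apply: ler_sum => i _.
  rewrite ler_pM2l// ler_expR ler_pM2l// /step_cost.
  by rewrite mulrBr; lra.
- by move=> A mA; rewrite big_bool /= addeC; exact: mustat.
- move=> theta th0; have [C hC] := total_height_locally_bounded th0.
  by exists (K * C) => x hx; rewrite ler_wpM2l ?weight_ge0// hC.
have m01 : measurable ([set x : R | 0 < x < 1] : set (measurableTypeR R)).
  by rewrite (_ : mkset _ = `]0, 1[%classic)// set_itvoo.
have mends : measurable ([set 0; 1] : set (measurableTypeR R)).
  by apply: measurableU; exact: measurable_set1.
apply/eqP; rewrite eq_le probability_le1//=.
rewrite -mu01 -(measureU0 m01 mends muends); apply: le_measure.
- by apply: mem_set; exact: measurable_itv.
- by apply: mem_set; exact: measurableU.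
move=> x; rewrite /= in_itv/= => /andP[]; rewrite le_eqVlt => /predU1P[<- _|x0].
  by right; left.
by rewrite le_eqVlt => /predU1P[->|x1]; [right; right|left; rewrite x0].
Qed.
End AMSystem.

(** * Dimension bound and admissible parameters *)

Section DimensionBound.
Variable R : realType.
Implicit Types (a gamma P x : R) (p : R * R).

Lemma entropy_max p : prob_vector p ->
  p.1 * ln p.1 + p.2 * ln p.2 =
  Num.max p.1 p.2 * ln (Num.max p.1 p.2)
  + (1 - Num.max p.1 p.2) * ln (1 - Num.max p.1 p.2).
Proof.
case: p => p1 p2 [/= p1_gt0 p2_gt0 p12]; case: leP => _.
  by rewrite (_ : 1 - p2 = p1) 1?addrC//; lra.
by rewrite (_ : 1 - p1 = p2)//; lra.
Qed.

(** ln z <= z - 1 at z = 1 / (2 P) and z = 1 / (2 (1 - P)). *)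
Lemma entropy_le_ln2 P : 0 < P < 1 -> - (P * ln P + (1 - P) * ln (1 - P)) <= ln 2.
Proof.
have half x : 0 < x -> - (x * ln x) <= x * ln 2 + (1 / 2 - x).
  move=> x0; have h := @expR_ge1Dx R (ln (1 / (2 * x))).
  have x2 : 0 < 1 / (2 * x) by rewrite divr_gt0// mulr_gt0.
  rewrite lnK ?posrE// in h.
  have lnE : ln (1 / (2 * x)) = - ln 2 - ln x.
    by rewrite div1r lnV ?posrE ?mulr_gt0// lnM ?posrE// opprD.
  rewrite lnE -(ler_pM2l x0) in h.
  have E : x * (1 / (2 * x)) = 1 / 2 by field; rewrite gt_eqF.
  by rewrite E in h; lra.
move=> /andP[P0 P1]; have h1 := half _ P0.
have P1' : 0 < 1 - P by lra.
have h2 := half _ P1'; lra.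
Qed.

Lemma dim_boundE a gamma P : 0 < a < 1 -> 0 < contraction_rate gamma P ->
  dim_bound a gamma P * (contraction_rate gamma P * - ln a) =
  - (P * ln P + (1 - P) * ln (1 - P)).
Proof.
move=> a01 c0; have la : ln a < 0 by rewrite ln_lt0.
rewrite /dim_bound -/(contraction_rate gamma P).
move: c0; set c := contraction_rate _ _ => c0.
by field; rewrite ?(gt_eqF c0) ?(lt_eqF la).
Qed.

Lemma dim_bound_lt1 a gamma P : 0 < P < 1 -> 0 < a < 1 ->
  ln 2 < contraction_rate gamma P * - ln a ->
  0 < contraction_rate gamma P -> dim_bound a gamma P < 1.
Proof.
move=> P01 a01 cl c0; have cl0 : 0 < contraction_rate gamma P * - ln a.
  by rewrite mulr_gt0// oppr_gt0 ln_lt0.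
rewrite -(ltr_pM2r cl0) dim_boundE// mul1r.
exact: le_lt_trans (entropy_le_ln2 P01) cl.
Qed.

(** The second condition is what puts x_+ below a / 2. *)
Lemma steep_small a gamma : 0 < a < 1 -> 1 < gamma < 2 ->
  ln 2 <= (gamma - 1) * - ln a -> a <= 1 / 2 /\ 2 <= a * a `^ (- gamma).
Proof.
move=> a01 /andP[g1 g2] h; have /andP[a0 a1] := a01; split.
  have ln2 : 0 < ln (2 : R) by rewrite ln_gt0// ltr1n.
  rewrite -ler_ln ?posrE// ?divr_gt0// div1r lnV ?posrE//.
  have h1 : 0 < - ln a.
    by rewrite oppr_gt0 ln_lt0.
  have : (gamma - 1) * - ln a <= - ln a by rewrite ler_piMl//; lra.
  lra.
rewrite -ler_ln ?posrE ?mulr_gt0 ?powR_gt0//.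
by rewrite lnM ?posrE ?powR_gt0// ln_powR; lra.
Qed.

Section Carrier.
Variables (a gamma : R) (p : R * R).
Let P := Num.max p.1 p.2.
Hypothesis a01 : 0 < a < 1.
Hypothesis gamma12 : 1 < gamma < 2.
Hypothesis pP : prob_vector p.
Hypothesis a_small : ln 2 <= (gamma - 1) * - ln a.
Hypothesis contracting : 0 < contraction_rate gamma P.

Variable mu : probability (measurableTypeR R) R.
Hypothesis mu_stat : stationary_measure a gamma p mu.

Lemma am_null_carrier (sigma : R) : dim_bound a gamma P < sigma -> 0 < sigma ->
  exists A : set (measurableTypeR R),
  [/\ measurable A, A `<=` `[0, 1]%classic, mu A = 1%E
    & sigma_null sigma A].
Proof.
move=> sigma_gt sigma_gt0; have /andP[a0 a1] := a01.
have /andP[g1 g2] := gamma12.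
have [a2 steep] := steep_small a01 gamma12 a_small.
apply: null_carrier => // [eta eta0|]; last by have [] := mu_stat.
have a_half : 0 < a <= 1 / 2 by rewrite a0.
apply: (am_finite_cover a_half g1 steep pP sigma_gt0 _ mu_stat eta0).
rewrite entropy_max// -/P.
have cl0 : 0 < contraction_rate gamma P * - ln a.
  by rewrite mulr_gt0// oppr_gt0 ln_lt0.
by rewrite -(dim_boundE a01 contracting) ltr_pM2r.
Qed.

Lemma dim_bound_ge0 : 0 <= dim_bound a gamma P.
Proof.
have /andP[a0 a1] := a01.
have cl0 : 0 < contraction_rate gamma P * - ln a.
  by rewrite mulr_gt0// oppr_gt0 ln_lt0.
rewrite -(pmulr_lge0 _ cl0) (dim_boundE a01 contracting) -entropy_max//.
have [p1 p2 p12] := pP.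
have h1 : p.1 * ln p.1 <= 0 by rewrite mulr_ge0_le0 ?ln_le0//; lra.
have h2 : p.2 * ln p.2 <= 0 by rewrite mulr_ge0_le0 ?ln_le0//; lra.
lra.
Qed.

Lemma am_dimension_le : (measure_hausdorff_dim mu <= (dim_bound a gamma P)%:E)%E.
Proof.
apply/lee_addgt0Pr => e e0; rewrite -EFinD.
have b0 := dim_bound_ge0.
have s0 : 0 < dim_bound a gamma P + e by lra.
have [|A [mA A01 muA thin]] := am_null_carrier _ s0; first by lra.
apply: le_trans (null_hausdorff_dim s0 thin).
by apply: ereal_inf_lbound; exists A.
Qed.

Lemma am_singular : dim_bound a gamma P < 1 -> lebesgue_singular mu.
Proof.
move=> lt1; have [A [mA A01 muA thin]] := am_null_carrier lt1 ltr01.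
exists A; split => //; first exact: null_lebesgue0 thin _ mA.
by have := probability_setC mu mA; rewrite muA subee.
Qed.
End Carrier.

Lemma x_plus_in a gamma : 0 < a < 1 -> 1 < gamma -> 0 < x_plus a gamma < 1 /\
  0 < x_minus a gamma < 1.
Proof.
move=> /andP[a0 a1] g1.
have b1 : 1 < a `^ (- gamma).
  rewrite -ltr_ln ?posrE ?powR_gt0// ln1 ln_powR mulNr -mulrN.
  by rewrite mulr_gt0 ?oppr_gt0 ?ln_lt0 ?a0//; lra.
rewrite /x_plus /x_minus !divr_gt0 ?subr_gt0//= ?(lt_trans a1)//.
by rewrite !ltr_pdivrMr ?subr_gt0 ?(lt_trans a1)//; lra.
Qed.

Lemma derive1_near_affine (f : R -> R) (k c x : R) :
  (\forall z \near x, f z = k * z + c) -> derive1 f x = k.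
Proof.
move=> fE; rewrite derive1E (near_eq_derive _ fE).
by rewrite derive_val addr0 /GRing.scale/= mulr1.
Qed.

Lemma positive_exponents_of a gamma p : 0 < a < 1 -> 1 < gamma -> prob_vector p ->
  0 < gamma * (1 - Num.max p.1 p.2) - Num.max p.1 p.2 ->
  positive_exponents a gamma p.
Proof.
move=> a01 g1 [p1 p2 p12] D0; have [xp xm] := x_plus_in a01 g1.
have /andP[xp0 xp1] := xp; have /andP[xm0 xm1] := xm.
have la : ln a < 0 by rewrite ln_lt0.
have lnb : ln (a `^ (- gamma)) = - gamma * ln a by rewrite ln_powR.
have bounds : p.1 < gamma * p.2 /\ p.2 < gamma * p.1.
  by move: D0; case: (leP p.1 p.2) => h D0; split; nra.
rewrite /positive_exponents /endpoint_exponent.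
rewrite (@derive1_near_affine (f_minus a gamma) a 0 0); last first.
  by move: (lt_nbhsl xm0); apply: filterS => z zx; rewrite /= addr0 /f_minus ltW.
rewrite (@derive1_near_affine (f_plus a gamma) (a `^ (- gamma)) 0 0); last first.
  by move: (lt_nbhsl xp0); apply: filterS => z zx; rewrite /= addr0 /f_plus ltW.
rewrite (@derive1_near_affine (f_minus a gamma) (a `^ (- gamma)) (1 - a `^ (- gamma)) 1);
  last first.
  move: (lt_nbhsr xm1); apply: filterS => z xz.
  by rewrite /= /f_minus leNgt xz /=; ring.
rewrite (@derive1_near_affine (f_plus a gamma) a (1 - a) 1); last first.
  move: (lt_nbhsr xp1); apply: filterS => z xz.
  by rewrite /= /f_plus leNgt xz /=; ring.
rewrite lnb; case: bounds => h1 h2; split; nra.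
Qed.
End DimensionBound.

(** At P = 1/2 the rate is (gamma - 1) (3/2 - gamma) / (4 gamma - 1), which is
bounded away from 0 for gamma between 6/5 and 13/10; the interval is therefore
admissible for all P close to 1/2. *)
Lemma contraction_rate_near_half (R : realType) (gamma P : R) :
  1 / 2 <= P < 1 / 2 + 1 / 1000 -> 6 / 5 < gamma < 13 / 10 ->
  1 / 200 <= contraction_rate gamma P /\ 0 < gamma * (1 - P) - P.
Proof.
move=> /andP[P0 P1] /andP[g0 g1]; split; last by nra.
have PP : P * (1 - P) <= 1 / 4 by nra.
have P2 : P ^+ 2 <= 63 / 250 by rewrite expr2; nra.
have d0 : 0 < gamma - P * (1 - P) by lra.
rewrite /contraction_rate lerBrDr -lerBrDl ler_pdivrMr//.
have h1 : (1 + gamma) * P ^+ 2 * (P + gamma) <= (1 + gamma) * (63 / 250) * (501 / 1000 + gamma).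
  rewrite ler_pM ?mulr_ge0 ?sqr_ge0//; try lra.
  by rewrite ler_pM2l//; lra.
(* The claim is quadratic and convex in gamma, so the end points decide. *)
have h2 : (gamma - 6 / 5) * (gamma - 13 / 10) <= 0 by nra.
nra.
Qed.

(** The exponent 200 matches the lower bound 1/200 of the rate: it gives
c |ln a| > ln 2, which exceeds the entropy. *)
Lemma near_half_parameters (R : realType) (a gamma : R) (p : R * R) :
  prob_vectors_near_half (1 / 1000) p -> 6 / 5 < gamma < 13 / 10 ->
  0 < a < 2 `^ (- 200) ->
  let P := Num.max p.1 p.2 in
  [/\ 0 < a < 1, 1 < gamma < 2, ln 2 <= (gamma - 1) * - ln a,
      0 < contraction_rate gamma P & positive_exponents a gamma p] /\
  dim_bound a gamma P < 1.
Proof.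
move=> [pP p1 p2] gamma_in /andP[a0 a_lt] P.
have [p1_gt0 p2_gt0 p12] := pP.
have P_in : 1 / 2 <= P < 1 / 2 + 1 / 1000.
  by rewrite /P gt_max p1 p2 andbT le_max; case: (leP (1 / 2) p.1) => //= ?; lra.
have [rate D0] := contraction_rate_near_half P_in gamma_in.
have ln2 : 0 < ln (2 : R) by rewrite ln_gt0// ltr1n.
have la : 200 * ln 2 < - ln a.
  by move: a_lt; rewrite -ltr_ln ?posrE ?powR_gt0// ln_powR; lra.
have a1 : a < 1 by rewrite -ltr_ln ?posrE// ln1; lra.
have la_gt0 : 0 < - ln a by lra.
have a01 : 0 < a < 1 by rewrite a0.
have /andP[g1 g2] := gamma_in.
have rate0 : 0 < contraction_rate gamma P by lra.
split.
  split => //; try lra.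
    have : 1 / 5 * - ln a <= (gamma - 1) * - ln a by rewrite ler_pM2r//; lra.
    lra.
  by apply: positive_exponents_of => //; lra.
apply: dim_bound_lt1 => //; first lra.
have : 1 / 200 * - ln a <= contraction_rate gamma P * - ln a by rewrite ler_pM2r.
lra.
Qed.

Lemma dim_bound_halfE (R : realType) (a gamma : R) : 1 < gamma < 3 / 2 -> 0 < a < 1 ->
  dim_bound_half a gamma = dim_bound a gamma (1 / 2).
Proof.
move=> /andP[g1 g2] a01; have la : ln a < 0 by rewrite ln_lt0.
rewrite /dim_bound_half /dim_bound.
rewrite (_ : 1 - 1 / 2 = 1 / 2 :> R); last by field.
rewrite div1r lnV ?posrE//.
have -> : 1 - (1 + gamma) * 2^-1 ^+ 2 * (2^-1 + gamma) / (gamma - 2^-1 * 2^-1) =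
    (gamma - 1) * (3 / 2 - gamma) / (4 * gamma - 1).
  by field; rewrite !gt_eqF//; lra.
field; rewrite (lt_eqF la) !gt_eqF//; lra.
Qed.

(** The bound on a says exactly that c |ln a| > ln 2. *)
Lemma half_parameters (R : realType) (a gamma : R) : 1 < gamma < 3 / 2 ->
  0 < a < 2 `^ ((1 - 4 * gamma) / ((gamma - 1) * (3 / 2 - gamma))) ->
  [/\ 0 < a < 1, ln 2 <= (gamma - 1) * - ln a,
      0 < contraction_rate gamma (1 / 2)
    & dim_bound a gamma (1 / 2) < 1].
Proof.
move=> /andP[g1 g2] /andP[a0 a_lt].
have ln2 : 0 < ln (2 : R) by rewrite ln_gt0// ltr1n.
have g0 : 0 < gamma - 1 by lra.
have g3 : 0 < 3 / 2 - gamma by lra.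
have g4 : 0 < 4 * gamma - 1 by lra.
have rateE : contraction_rate gamma (1 / 2) =
    (gamma - 1) * (3 / 2 - gamma) / (4 * gamma - 1).
  by rewrite /contraction_rate; field; rewrite !gt_eqF//; lra.
have rate0 : 0 < contraction_rate gamma (1 / 2) by rewrite rateE !mulr_gt0// invr_gt0.
have la : ln 2 < contraction_rate gamma (1 / 2) * - ln a.
  move: a_lt; rewrite -ltr_ln ?posrE ?powR_gt0// ln_powR.
  rewrite -(ltr_pM2l rate0) mulrA.
  have -> : contraction_rate gamma (1 / 2) *
     ((1 - 4 * gamma) / ((gamma - 1) * (3 / 2 - gamma))) = - 1.
    by rewrite rateE; field; rewrite !gt_eqF//; lra.
  lra.
have a1 : a < 1.
  rewrite -ltr_ln ?posrE// ln1 -oppr_gt0 -(pmulr_rgt0 _ rate0).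
  exact: lt_trans la.
have a01 : 0 < a < 1 by rewrite a0.
split => //; last by apply: dim_bound_lt1 => //; lra.
apply: (le_trans (ltW la)); rewrite ler_pM2r ?oppr_gt0 ?ln_lt0//.
rewrite rateE -mulrA ler_piMr ?(ltW g0)// ler_pdivrMr//; lra.
Qed.

Theorem theorem2p1 (R : realType) :
  [/\ (exists V : set ((R * R) * (R * R)),
         [/\ open V, V `&` AM_space !=set0
           & forall (a gamma : R) (p : R * R), (V `&` AM_space) ((a, gamma), p) ->
               forall mu : probability (measurableTypeR R) R,
                 stationary_measure a gamma p mu ->
                 lebesgue_singular mu /\ (measure_hausdorff_dim mu < 1)%E]),
      (exists (delta : R) (Jl Jr : R * R -> R),
         [/\ 0 < delta,
             {within prob_vectors_near_half delta, continuous Jl},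
             {within prob_vectors_near_half delta, continuous Jr}
           & forall p : R * R, prob_vectors_near_half delta p ->
               [/\ 1 <= Jl p, Jl p < Jr p, Jr p <= 3 / 2
                 & exists a_max : R -> R,
                     {within `]Jl p, Jr p[, continuous a_max} /\
                     forall gamma : R, Jl p < gamma < Jr p ->
                       0 < a_max gamma <= 1 /\
                       forall a : R, 0 < a < a_max gamma ->
                         [/\ positive_exponents a gamma p,
                             (forall mu : probability (measurableTypeR R) R,
                                stationary_measure a gamma p mu ->
                                (measure_hausdorff_dim mu <=
                                 (dim_bound a gamma (Num.max p.1 p.2))%:E)%E)
                           & dim_bound a gamma (Num.max p.1 p.2) < 1]]])
    & (forall gamma a : R, 1 < gamma < 3 / 2 ->
         0 < a < 2 `^ ((1 - 4 * gamma) / ((gamma - 1) * (3 / 2 - gamma))) ->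
         (forall mu : probability (measurableTypeR R) R,
            stationary_measure a gamma (1 / 2, 1 / 2) mu ->
            (measure_hausdorff_dim mu <= (dim_bound_half a gamma)%:E)%E) /\
         dim_bound_half a gamma < 1) ].

Proof.
split.
- pose V : set ((R * R) * (R * R)) :=
    (fun t => t.1.1) @^-1` [set x | x < 2 `^ (- 200)] `&`
    ((fun t => t.1.2) @^-1` [set x | 6 / 5 < x] `&`
     (fun t => t.1.2) @^-1` [set x | x < 13 / 10]) `&`
    ((fun t => t.2.1) @^-1` [set x | x < 1 / 2 + 1 / 1000] `&`
     (fun t => t.2.2) @^-1` [set x | x < 1 / 2 + 1 / 1000]).
  exists V; split.
  + have c11 : continuous (fun t : (R * R) * (R * R) => t.1.1).
      by move=> t; apply: continuous_comp; exact: cvg_fst.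
    have c12 : continuous (fun t : (R * R) * (R * R) => t.1.2).
      by move=> t; apply: continuous_comp; [exact: cvg_fst|exact: cvg_snd].
    have c21 : continuous (fun t : (R * R) * (R * R) => t.2.1).
      by move=> t; apply: continuous_comp; [exact: cvg_snd|exact: cvg_fst].
    have c22 : continuous (fun t : (R * R) * (R * R) => t.2.2).
      by move=> t; apply: continuous_comp; exact: cvg_snd.
    by repeat apply: openI; apply: open_comp => //; (exact: open_lt || exact: open_gt).
  + have a_lt : (2 : R) `^ (- 201) < 2 `^ (- 200).
      rewrite -ltr_ln ?posrE ?powR_gt0// !ln_powR.
      by rewrite ltr_pM2r ?ln_gt0 ?ltr1n//; lra.
    have pP : prob_vector ((1 / 2, 1 / 2) : R * R) by split => /=; lra.
    have near : prob_vectors_near_half (1 / 1000) ((1 / 2, 1 / 2) : R * R).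
      by split => //=; lra.
    have g_in : 6 / 5 < (5 / 4 : R) < 13 / 10 by lra.
    have a_in : 0 < (2 : R) `^ (- 201) < 2 `^ (- 200) by rewrite powR_gt0.
    have [[a01 _ _ _ pos] _] := near_half_parameters near g_in a_in.
    exists ((2 `^ (- 201), 5 / 4), (1 / 2, 1 / 2)); split.
      by split; split => //=; lra.
    by split => //=; lra.
  + move=> a gamma p [[[/= a_lt [/= g1 g2]] [/= p1 p2]] [/= /andP[a0 _] _ pP _]] mu mu_stat.
    have near : prob_vectors_near_half (1 / 1000) p by split.
    have gamma_in : 6 / 5 < gamma < 13 / 10 by rewrite g1.
    have a_in : 0 < a < 2 `^ (- 200) by rewrite a0.
    have [[a01 g12 a_small rate _] lt1] := near_half_parameters near gamma_in a_in.
    split; first exact: am_singular mu_stat lt1.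
    by apply: le_lt_trans (am_dimension_le a01 g12 pP a_small rate mu_stat) _.
- exists (1 / 1000), (fun=> 6 / 5), (fun=> 13 / 10); split.
  + lra.
  + by apply: continuous_subspaceT => x; exact: cst_continuous.
  + by apply: continuous_subspaceT => x; exact: cst_continuous.
  + move=> p near; split; [lra..|].
    exists (fun=> 2 `^ (- 200)); split.
      by apply: continuous_subspaceT => x; exact: cst_continuous.
    move=> gamma gamma_in; split.
      by rewrite powR_gt0//= -[leRHS](powRr0 2); apply: ler_powR; lra.
    move=> a a_in; have [[a01 g12 a_small rate pos] lt1] :=
      near_half_parameters near gamma_in a_in.
    have [pP _ _] := near.
    by split => // mu; exact: am_dimension_le.
- move=> gamma a gamma_in a_in.
  have [a01 a_small rate lt1] := half_parameters gamma_in a_in.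
  rewrite dim_bound_halfE//; split => // mu mu_stat.
  have pP : prob_vector ((1 / 2, 1 / 2) : R * R) by split => /=; lra.
  have g12 : 1 < gamma < 2 by lra.
  have := am_dimension_le a01 g12 pP a_small _ mu_stat.
  by rewrite /= maxxx; exact.
Qed.
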